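(* Let $T\subset\mathbb{N}=\{1,2,\dots\}$ be finite, let $m\ge1$ be an integer, let $r_i\ge 0$ be integers for $i\in T$, and let $\alpha\in\mathbb{F}_q$. Let $N(m,\prod_{i\in T}I_i^{r_i},\langle x+\alpha\rangle)$ be the number of monic polynomials over $\mathbb{F}_q$ of degree $m$ whose coefficient of $x^{m-1}$ is $\alpha$ and which, for each $i\in T$, have exactly $r_i$ distinct monic irreducible factors of degree $i$. Then $$N\Big(m,\prod_{i\in T}I_i^{r_i},\langle x+\alpha\rangle\Big)=q^{m-1}\sum_{(j_i)_{i\in T}}\mathbf{1}\Big[\sum_{i\in T}i(r_i+j_i)\le m\Big]\prod_{i\in T}\binom{|I_i|}{r_i}q^{-ir_i}q^{-ij_i}\binom{|I_i|-r_i}{j_i}(-1)^{j_i}$$ $$\qquad+\frac{v(\alpha)}{q}\sum_{(k_i)_{i\in T}}\mathbf{1}\Big[\sum_{i\in T}ik_i=m\Big]\prod_{i\in T}A_{k_i}(a_i,b_i)\binom{k_i}{r_i}(-1)^{k_i-r_i},$$ where the first sum runs over tuples of integers $0\le j_i\le|I_i|-r_i$ (empty if some $r_i>|I_i|$), the second over tuples of integers $k_i\ge0$, and $v(\alpha)=q\,\mathbf{1}[\alpha=0]-1$.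
   Context: $\mathbb{F}_q$ is a finite field with $q=p^e$ elements, $p$ prime, $e\ge1$, and $I_i$ is the set of monic irreducible polynomials of degree $i$ over $\mathbb{F}_q$. For $i\ge1$ put $$a_i=\frac{1}{iq}\sum_{k\mid i,\;p\nmid k}\mu(k)q^{i/k},\qquad b_i=\frac1i\sum_{k\mid i,\;p\mid k}\mu(k)q^{i/k},$$ with $\mu$ the Möbius function; these are integers ($b_i$ may be negative). For integers $k\ge 0$, $a,b$, put $$A_k(a,b)=\sum_{j=0}^{\lfloor k/p\rfloor}\binom{aq/p}{j}\binom{b}{k-pj}(-1)^{j+pj}\quad(b\ne0),\qquad A_k(a,0)=\binom{aq/p}{k/p}(-1)^{k+k/p}\,\mathbf{1}[p\mid k].$$ Binomial coefficients are generalized: $\binom{x}{n}=x(x-1)\cdots(x-n+1)/n!$ for integers $n\ge0$. $\mathbf{1}[P]$ is $1$ if $P$ is true and $0$ otherwise (and $A_k(a,0)=0$ when $p\nmid k$). *)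

(* Defs.v *)
From HB Require Import structures.
From mathcomp Require Import all_boot all_order all_algebra all_field.
From mathcomp Require Import qpoly finmap.

Set Implicit Arguments.
Unset Strict Implicit.
Unset Printing Implicit Defensive.

Import Order.TTheory GRing.Theory Num.Theory.
Local Open Scope ring_scope.

(* [k] is meant to be positive; squarefree means that every prime divisor has
   valuation 1. *)
Definition moebius (k : nat) : int :=
  if all (fun l => logn l k == 1%N) (primes k) then (-1) ^+ size (primes k)
  else 0.

Definition gbinom (x : rat) (n : nat) : rat :=
  (\prod_(i < n) (x - i%:R)) / n`!%:R.

(* [{poly_n F}] is the finite type of polynomials of size at most n, that is,
   of degree < n. *)
Definition monics (F : finFieldType) (n : nat) : {set {poly_n.+1 F}} :=
  [set f : {poly_n.+1 F} | (size f == n.+1) && (polyn f \is monic)].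

Definition monic_irreds (F : finFieldType) (i : nat) : {set {poly_i.+1 F}} :=
  [set f in monics F i | irreducibleb f].

Definition nb_irred_factors (F : finFieldType) (i : nat) (f : {poly F}) : nat :=
  #|[set g in monic_irreds F i | polyn g %| f]|.

Definition nb_polys (F : finFieldType) (m : nat) (T : {fset nat})
    (r : T -> nat) (alpha : F) : nat :=
  #|[set f in monics F m | (f`_m.-1 == alpha) &&
       [forall i : T, nb_irred_factors (val i) f == r i]]|.

(* [a_coef] and [b_coef] are integer-valued for q a power of the prime p, but
   this is not needed to define them; they are taken in [rat]. *)
Definition a_coef (p q i : nat) : rat :=
  (i * q)%:R^-1 *
  \sum_(k <- divisors i | ~~ (p %| k)%N) (moebius k)%:~R * q%:R ^+ (i %/ k)%N.

Definition b_coef (p q i : nat) : rat :=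
  i%:R^-1 *
  \sum_(k <- divisors i | (p %| k)%N) (moebius k)%:~R * q%:R ^+ (i %/ k)%N.

Definition A_coef (p q k : nat) (a b : rat) : rat :=
  if b != 0 then
    \sum_(j < (k %/ p).+1)
       gbinom (a * q%:R / p%:R) j * gbinom b (k - p * j)%N * (-1) ^+ (j + p * j)
  else if (p %| k)%N then
    gbinom (a * q%:R / p%:R) (k %/ p)%N * (-1) ^+ (k + k %/ p)
  else 0.

Definition v_weight (F : finFieldType) (alpha : F) : rat :=
  #|F|%:R * (alpha == 0)%:R - 1.

(* Main.v *)
Require Import Defs.
From HB Require Import structures.
From mathcomp Require Import all_boot all_order all_algebra all_field.
From mathcomp Require Import all_fingroup all_character.
From mathcomp Require Import qpoly finmap zify ring lra.

(* Inclusion-exclusion reduces the count to families of distinct irreducibles,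
   k_i of them of degree i, whose product g divides f.  If deg g < m, the number
   of f does not depend on alpha and gives the first sum; if deg g = m, then
   f = g, and one has to count the families with prescribed sum of second
   coefficients.  Additive characters psi of F do this: the trivial one completes
   the first sum, and a nontrivial one turns the families of degree i into the
   coefficient of X^k in prod_P (1 + psi(second coefficient of P) X), P in I_i.

   The second coefficient takes each nonzero value a_i times on I_i and the value
   0 exactly a_i + b_i times, while prod_t (1 + psi(t) X) = (1 - (-X)^p)^(q/p) over
   t in F, so this product is (1 - (-X)^p)^(a_i q/p) (1 + X)^(b_i), whose
   coefficients are the A_k(a_i, b_i).

   The distribution of the second coefficient follows from a double count of the
   pairs (f, P^k) with P^k | f, f monic of degree n with second coefficient t: it
   shows that the sum over i | n of i #{P in I_i : (n/i) (second coefficient of P)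
   = t} is independent of t, which is then solved by Moebius inversion. *)

Set Implicit Arguments.
Unset Strict Implicit.
Unset Printing Implicit Defensive.

Import Order.TTheory GRing.Theory Num.Theory.
Local Open Scope ring_scope.

(** * Moebius inversion *)

Lemma moebius_prime_mul (l d : nat) :
  prime l -> (0 < d)%N -> ~~ (l %| d)%N -> moebius (l * d) = - moebius d.
Proof.
move=> pl d0 ld.
have pP : perm_eq (primes (l * d)) (l :: primes d).
  apply: uniq_perm; rewrite /= ?primes_uniq ?andbT //.
    by rewrite mem_primes pl d0 (negbTE ld).
  by move=> x; rewrite primesM ?(prime_gt0 pl) // primes_prime // !inE.
have aP : all (fun x => logn x (l * d) == 1%N) (primes (l * d)) =
          all (fun x => logn x d == 1%N) (primes d).
  rewrite (perm_all _ pP) /= lognM ?(prime_gt0 pl) // logn_prime // eqxx.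
  rewrite lognE pl d0 (negbTE ld) /=; apply: eq_in_all => x.
  rewrite mem_primes => /and3P[px _ xd].
  rewrite lognM ?(prime_gt0 pl) // logn_prime //.
  by case: (x =P l) => // xl; rewrite -xl xd in ld.
by rewrite /moebius aP (perm_size pP) /= exprS mulN1r; case: ifP; rewrite ?oppr0.
Qed.

(** Let [l] be the least prime divisor of [n]. The divisors with [l]-valuation at least 2 contribute
    0, and those with valuation 1 are [l * k] for [k] of valuation 0, so the rest cancels in
    pairs. *)
Lemma sum_moebius (n : nat) :
  (0 < n)%N -> \sum_(k <- divisors n) moebius k = (n == 1%N)%:R.
Proof.
move=> n0; have [->|n1] := eqVneq n 1%N.
  by rewrite big_seq1.
have pl : prime (pdiv n) by rewrite pdiv_prime // ltn_neqAle eq_sym n1.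
have ln := pdiv_dvd n; set l := pdiv n in pl ln.
have l0 := prime_gt0 pl.
rewrite (bigID (fun k => logn l k == 0%N)) /=.
rewrite [X in _ + X](bigID (fun k => logn l k == 1%N)) /=.
rewrite [X in _ + (_ + X)]big1_seq ?addr0; last first.
  move=> k /andP[/andP[lk0 lk1]] _.
  rewrite /moebius; case: allP => // /(_ l); rewrite -logn_gt0 lt0n lk0.
  by rewrite (negbTE lk1) => /(_ isT).
rewrite [X in _ + X](eq_bigl (fun k => (logn l k == 1%N))); last first.
  by move=> k; case: (logn l k) => [|[]].
have -> : \sum_(k <- divisors n | logn l k == 1%N) moebius k =
   \sum_(k <- [seq l * k | k <- [seq k <- divisors n | logn l k == 0]]%N)
      moebius k.
  rewrite -big_filter; apply: perm_big; apply: uniq_perm.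
  - by rewrite filter_uniq ?divisors_uniq.
  - rewrite map_inj_in_uniq ?filter_uniq ?divisors_uniq // => x y _ _ /eqP.
    by rewrite eqn_pmul2l // => /eqP.
  move=> x; rewrite mem_filter -dvdn_divisors //; apply/andP/mapP.
    move=> [/eqP lx xn]; have x0 := dvdn_gt0 n0 xn.
    have lx' : (l %| x)%N by rewrite -[l]expn1 pfactor_dvdn // lx.
    exists (x %/ l)%N; last by rewrite mulnC divnK.
    rewrite mem_filter -dvdn_divisors // (dvdn_trans (dvdn_div lx')) // andbT.
    by rewrite logn_div // lx logn_prime // eqxx.
  move=> [y]; rewrite mem_filter -dvdn_divisors // => /andP[/eqP ly yn] ->.
  have y0 := dvdn_gt0 n0 yn.
  rewrite lognM // ly logn_prime // eqxx; split=> //.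
  rewrite Gauss_dvd ?ln ?yn // prime_coprime //; apply/negP.
  by rewrite -[X in (X %| _)%N]expn1 pfactor_dvdn // ly.
rewrite big_map big_filter -big_split /= big1_seq // => k /andP[/eqP lk].
rewrite -dvdn_divisors // => kn; have k0 := dvdn_gt0 n0 kn.
rewrite moebius_prime_mul ?subrr //.
by rewrite -[X in (X %| _)%N]expn1 pfactor_dvdn // lk.
Qed.

Lemma big_divisors_compl (R : nmodType) (n : nat) (P : pred nat) (G : nat -> R) :
  (0 < n)%N ->
  \sum_(k <- divisors n | P k) G k =
    \sum_(k <- divisors n | P (n %/ k)%N) G (n %/ k)%N.
Proof.
move=> n0; have nK : {in divisors n, involutive (divn n)}.
  move=> x; rewrite -dvdn_divisors // => xn.
  by rewrite divnA // mulKn.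
rewrite -(big_map (fun k => n %/ k)%N P G); apply: perm_big.
apply: uniq_perm; rewrite ?divisors_uniq //.
  by rewrite map_inj_in_uniq ?divisors_uniq //; apply: can_in_inj nK.
have dn x : x \in divisors n -> (n %/ x)%N \in divisors n.
  by rewrite -!dvdn_divisors // => /dvdn_div.
move=> x; apply/idP/mapP => [xn|[y yn ->]]; last exact: dn.
by exists (n %/ x)%N; rewrite ?nK // dn.
Qed.

(** As [chi] is completely multiplicative, [moebius] restricted to [chi] is the Dirichlet inverse of
    [chi]. It is used with [chi] always true, for [#|I_i|], and with [chi] meaning prime to [p], for
    [a_i]. *)
Lemma moebius_inversion (R : comPzRingType) (chi : pred nat) (h : nat -> R)
    (n : nat) :
  chi 1%N -> {morph chi : a b / (a * b)%N >-> a && b} -> (0 < n)%N ->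
  \sum_(i <- divisors n | chi (n %/ i)%N)
     \sum_(k <- divisors i | chi k) (moebius k)%:~R * h (i %/ k)%N = h n.
Proof.
move=> chi1 chiM n0.
have inner i : (0 < i)%N -> (i %| n)%N ->
    \sum_(k <- divisors i | chi k) (moebius k)%:~R * h (i %/ k)%N =
    \sum_(e <- divisors n | (e %| i)%N && chi (i %/ e)%N)
       (moebius (i %/ e)%N)%:~R * h e :> R.
  move=> i0 din; rewrite big_divisors_compl //.
  have -> : \sum_(e <- divisors n | (e %| i)%N && chi (i %/ e)%N)
       (moebius (i %/ e)%N)%:~R * h e =
     \sum_(e <- [seq e <- divisors n | e %| i]%N | chi (i %/ e)%N)
       (moebius (i %/ e)%N)%:~R * h e :> R by rewrite big_filter_cond.
  have pe : perm_eq [seq e <- divisors n | e %| i]%N (divisors i).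
    apply: uniq_perm; rewrite ?filter_uniq ?divisors_uniq // => e.
    rewrite mem_filter -!dvdn_divisors //; case: (boolP (e %| i)%N) => //= ei.
    exact: dvdn_trans din.
  rewrite (perm_big _ pe) /= big_seq_cond [RHS]big_seq_cond.
  apply: eq_bigr => e /andP[].
  by rewrite -dvdn_divisors // => ei _; rewrite divnA // mulKn.
rewrite big_seq_cond (eq_bigr (fun i =>
    \sum_(e <- divisors n | (e %| i)%N && chi (i %/ e)%N)
       (moebius (i %/ e)%N)%:~R * h e)); last first.
  move=> i /andP[]; rewrite -dvdn_divisors // => din _.
  by rewrite inner // (dvdn_gt0 n0 din).
rewrite -big_seq_cond (exchange_big_dep predT) //=.
(* The two conditions on [i] merge into [chi (n %/ e)], which is free of [i]; with [i = e * k] there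
   remains the sum of [moebius] over the divisors of [n %/ e]. *)
have outer e : (e %| n)%N ->
    \sum_(i <- divisors n | chi (n %/ i)%N && ((e %| i)%N && chi (i %/ e)%N))
       (moebius (i %/ e)%N)%:~R * h e = (e == n)%:R * h n :> R.
  move=> en; have e0 := dvdn_gt0 n0 en.
  rewrite -mulr_suml.
  have -> : \sum_(i <- divisors n | chi (n %/ i)%N && ((e %| i)%N && chi (i %/ e)%N))
       (moebius (i %/ e)%N)%:~R =
     \sum_(i <- [seq i <- divisors n | e %| i]%N |
            chi (n %/ i)%N && chi (i %/ e)%N) (moebius (i %/ e)%N)%:~R :> R.
    by rewrite big_filter_cond; apply: eq_bigl => i; rewrite andbCA.
  have pe : perm_eq [seq i <- divisors n | e %| i]%N
     [seq e * k | k <- divisors (n %/ e)]%N.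
    have ne0 : (0 < n %/ e)%N by rewrite divn_gt0 // dvdn_leq.
    apply: uniq_perm; rewrite ?filter_uniq ?divisors_uniq //.
      rewrite map_inj_uniq ?divisors_uniq // => x y /eqP.
      by rewrite eqn_pmul2l // => /eqP.
    move=> i; rewrite mem_filter -dvdn_divisors //; apply/andP/mapP.
      move=> [/dvdnP[k ->]] kn; exists k; last by rewrite mulnC.
      by rewrite -dvdn_divisors // dvdn_divRL.
    move=> [k]; rewrite -dvdn_divisors // dvdn_divRL // => kn ->.
    by rewrite dvdn_mulr // mulnC.
  rewrite (perm_big _ pe) /= big_map big_seq_cond.
  rewrite (eq_big (fun k => (k \in divisors (n %/ e)) && chi (n %/ e)%N)
     (fun k => (moebius k)%:~R)); first last.
  - by move=> k _; rewrite mulKn.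
  - move=> k; case: (boolP (k \in _)) => //=.
    have ne0 : (0 < n %/ e)%N by rewrite divn_gt0 // dvdn_leq.
    rewrite -dvdn_divisors // => kn.
    rewrite mulKn // -chiM; congr (chi _).
    by rewrite divnMA divnK.
  rewrite -big_seq_cond -(big_morph _ (@intrD R) (mulr0z 1)).
  have ne0 : (0 < n %/ e)%N by rewrite divn_gt0 // dvdn_leq.
  case: (boolP (chi _)) => [_|]; last first.
    rewrite big_pred0 // mulr0z mul0r; case: (eqVneq e n) => [->|_ _].
      by rewrite divnn n0 chi1.
    by rewrite mul0r.
  rewrite sum_moebius // -(eqn_pmul2r e0) divnK // mul1n eq_sym.
  by case: eqP => [->|_]; rewrite ?mul1r ?mul0r.
rewrite big_seq (eq_bigr (fun e => (e == n)%:R * h n)); last first.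
  by move=> e; rewrite -dvdn_divisors // => /outer.
rewrite -big_seq (bigD1_seq n) ?divisors_uniq ?divisors_id //= eqxx mul1r.
by rewrite big1 ?addr0 // => e /negbTE->; rewrite mul0r.
Qed.

(** The system is triangular for divisibility, and its diagonal entry at [n] is [n], which is
    nonzero. *)
Lemma divisor_sum_inj (chi : pred nat) (u v : nat -> rat) :
  chi 1%N ->
  (forall n, (0 < n)%N ->
     \sum_(i <- divisors n | chi (n %/ i)%N) i%:R * u i =
     \sum_(i <- divisors n | chi (n %/ i)%N) i%:R * v i) ->
  forall n, (0 < n)%N -> u n = v n.
Proof.
move=> chi1 uv; elim/ltn_ind => n IH n0; have := uv n n0.
rewrite big_mkcond [RHS]big_mkcond.
rewrite !(bigD1_seq n) ?divisors_uniq ?divisors_id //= divnn n0 chi1.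
rewrite big_seq_cond (eq_bigr (fun i => if chi (n %/ i)%N then i%:R * v i else 0)).
  rewrite -big_seq_cond => /addIr/mulfI; apply.
  by rewrite pnatr_eq0 -lt0n.
move=> i /andP[]; rewrite -dvdn_divisors // => din nin.
by rewrite IH ?(dvdn_gt0 n0 din) // ltn_neqAle nin dvdn_leq.
Qed.

(** * The second coefficient of a monic polynomial *)

Lemma monic_size1 (R : nzRingType) (g : {poly R}) :
  g \is monic -> size g = 1%N -> g = 1.
Proof.
move=> /monicP gm sg; have /size1_polyC gE : (size g <= 1)%N by rewrite sg.
by rewrite gE; move: gm; rewrite gE lead_coefC coefC /= => ->.
Qed.

(* The factor ['X] makes the value 0 at the constant 1, so that products of monic
   polynomials, constant or not, go to sums. *)
Definition nextcoef (R : nzRingType) (g : {poly R}) : R := ('X * g)`_(size g).-1.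

Lemma nextcoef1 (R : nzRingType) : nextcoef (1 : {poly R}) = 0.
Proof. by rewrite /nextcoef mulr1 size_poly1 coefX. Qed.

Lemma nextcoefE (R : nzRingType) (g : {poly R}) n :
  size g = n.+2 -> nextcoef g = g`_n.
Proof. by move=> sg; rewrite /nextcoef sg coefXM. Qed.

Lemma nextcoefM (R : idomainType) (g h : {poly R}) :
  g \is monic -> h \is monic -> nextcoef (g * h) = nextcoef g + nextcoef h.
Proof.
move=> gm hm; have h0 := monic_neq0 hm.
have [a sg] : {a | size g = a.+1}.
  by exists (size g).-1; rewrite prednK // size_poly_gt0 monic_neq0.
have [[sh|b sh]] : {b | size h = b.+1}.
- by exists (size h).-1; rewrite prednK // size_poly_gt0.
- by rewrite (monic_size1 hm sh) mulr1 nextcoef1 addr0.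
have ga : g`_a = 1 by have := monicP gm; rewrite lead_coefE sg.
have hb : h`_b.+1 = 1 by have := monicP hm; rewrite lead_coefE sh.
rewrite (nextcoefE sh) {1}/nextcoef size_monicM // sg sh addSn !addnS /=.
(* Here [g] has degree [a] and [h] degree [b.+1]. In the convolution of ['X * g] with [h] only the
   indices [a] and [a.+1] survive, giving the second coefficients of [g] and of [h]. *)
have ltaN : (a < (a + b).+2)%N by lia.
have ltaN' : (a.+1 < (a + b).+2)%N by lia.
rewrite mulrA coefM (bigD1 (Ordinal ltaN)) //=.
rewrite (_ : (a + b).+1 - a = b.+1)%N; last by lia.
rewrite hb mulr1.
rewrite {1}/nextcoef sg /=; congr (_ + _).
rewrite (bigD1 (Ordinal ltaN')) /=; last by rewrite -val_eqE /=; lia.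
rewrite (_ : (a + b).+1 - a.+1 = b)%N; last by lia.
rewrite coefXM ga mul1r big1 ?addr0 // => i.
rewrite -!val_eqE /= => /andP[ia ia1]; have [lt_ia|le_ai] := ltnP i a.
  by rewrite [h`__]nth_default ?mulr0 // sh; lia.
rewrite [('X * g)`__]nth_default ?mul0r // (leq_trans (size_polyMleq _ _)) //.
by rewrite size_polyX sg /=; lia.
Qed.

Lemma nextcoef_prod (R : idomainType) I (s : seq I) (P : pred I)
    (g : I -> {poly R}) :
  (forall i, P i -> g i \is monic) ->
  nextcoef (\prod_(i <- s | P i) g i) = \sum_(i <- s | P i) nextcoef (g i).
Proof.
move=> gm; suff [] : \prod_(i <- s | P i) g i \is monic /\
  nextcoef (\prod_(i <- s | P i) g i) = \sum_(i <- s | P i) nextcoef (g i) by [].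
apply: (big_rec2 (fun x y => x \is monic /\ nextcoef x = y)).
  by rewrite monic1 nextcoef1.
by move=> i x y Pi [xm <-]; rewrite monicMr ?gm // nextcoefM ?gm.
Qed.

Lemma nextcoefX (R : idomainType) (g : {poly R}) n :
  g \is monic -> nextcoef (g ^+ n) = nextcoef g *+ n.
Proof.
move=> gm; elim: n => [|n IH]; first by rewrite nextcoef1.
by rewrite exprS nextcoefM ?rpredX // IH mulrS.
Qed.

(** In positive degree all coefficients below the second are free; in degree 0 there is only the
    constant 1, of value 0. *)
Lemma card_monics_nextcoef (F : finFieldType) n (t : F) :
  #|[set h in monics F n | nextcoef h == t]| =
    if n is n'.+1 then (#|F| ^ n')%N else (t == 0).
Proof.
case: n => [|n].
  have e1 : (size (1%R : {poly F}) <= 1)%N by rewrite size_poly1.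
  transitivity #|[set h : {poly_1 F} | (h == NPoly e1) && (t == 0)]|; last first.
    case: (t == 0); last by apply: eq_card0 => h; rewrite !inE andbF.
    transitivity #|[set NPoly e1]|; last by rewrite cards1.
    by apply: eq_card => h; rewrite !inE andbT.
  apply: eq_card => h; rewrite !inE; case: (h =P NPoly e1) => [->|hn] /=.
    by rewrite size_poly1 monic1 nextcoef1 eq_sym.
  apply/negbTE/negP => /andP[/andP[/eqP sh hm] _]; apply: hn; apply: val_inj.
  exact: monic_size1.
pose phi (u : {poly_n F}) : {poly_n.+2 F} :=
  npolyp n.+2 ('X^(n.+1) + (t *: 'X^n + u)).
have su (u : {poly_n F}) : (size (t *: 'X^n + u : {poly F})%R < n.+2)%N.
  rewrite ltnS (leq_trans (size_polyD _ _)) // geq_max.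
  by rewrite (leq_trans (size_scale_leq _ _)) ?size_polyXn // leqW.
have sphi (u : {poly_n F}) : size ('X^(n.+1) + (t *: 'X^n + u) : {poly F}) = n.+2.
  by rewrite size_polyDl size_polyXn.
have phiE u : phi u = 'X^(n.+1) + (t *: 'X^n + u) :> {poly F}.
  by rewrite npolypK // sphi.
have phi_inj : injective phi.
  move=> u v /(congr1 (@polyn _ _)); rewrite !phiE => /addrI/addrI.
  exact: val_inj.
rewrite -[(#|F| ^ n)%N](card_npoly) -(card_imset _ phi_inj).
apply: eq_card => h; apply/idP/imsetP => [|[u _ ->]].
  rewrite !inE => /andP[/andP[/eqP sh /monicP hm] /eqP th].
  exists (npolyp n h) => //; apply: val_inj => /=; rewrite phiE.
  rewrite (nextcoefE sh) in th; rewrite lead_coefE sh /= in hm.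
  apply/polyP => i; rewrite !coefD coefZ !coefXn coef_npolyp.
  case: (ltngtP i n) => [lt_in|lt_ni|->].
  - by rewrite (ltn_eqF (leqW lt_in)) mulr0 !add0r.
  - rewrite mulr0 !add0r addr0; case: eqP => [->//|/eqP ni].
    by rewrite nth_default // sh ltn_neqAle eq_sym ni.
  - by rewrite (ltn_eqF (leqnn _)) mulr1 add0r addr0.
rewrite !inE phiE (nextcoefE (sphi u)) sphi eqxx monicE lead_coefE sphi /=.
rewrite !coefD !coefZ !coefXn eqxx (gtn_eqF (leqnn _)) (ltn_eqF (leqnn _)).
by rewrite !big_coef_npoly // eqxx mulr0 mulr1 !addr0 add0r !eqxx.
Qed.

(** Multiplication by [g] is a bijection onto the multiples, and it shifts the second coefficient by
    [nextcoef g]. *)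
Lemma card_monics_dvd (F : finFieldType) m d (t : F) (g : {poly F}) :
  g \is monic -> size g = d.+1 ->
  #|[set f in monics F m | (nextcoef f == t) && (g %| polyn f)]| =
    if (d <= m)%N then
      #|[set h in monics F (m - d) | nextcoef h == t - nextcoef g]| else 0%N.
Proof.
move=> gm sg; have g0 := monic_neq0 gm; case: leqP => [dm|md]; last first.
  apply: eq_card0 => f; rewrite !inE; apply/negP.
  move=> /andP[/andP[/eqP sf fm] /andP[_ /dvdp_leq]].
  by rewrite monic_neq0 // sf sg ltnS leqNgt md => /(_ isT).
pose phi (h : {poly_(m - d).+1 F}) : {poly_m.+1 F} := npolyp m.+1 (g * h).
have phiE h : phi h = g * h :> {poly F}.
  rewrite npolypK // (leq_trans (size_polyMleq _ _)) // sg /=.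
  by apply: leq_trans (leq_add (leqnn d) (size_npoly h)) _; lia.
have phi_inj : injective phi.
  move=> u v /(congr1 (@polyn _ _)); rewrite !phiE => /(mulfI g0).
  exact: val_inj.
rewrite -(card_imset _ phi_inj); apply: eq_card => f.
apply/idP/imsetP => [|[h]].
  rewrite !inE => /andP[/andP[/eqP sf fm] /andP[/eqP tf /dvdpP[h fE]]].
  rewrite mulrC in fE; have hm : h \is monic by rewrite fE monicMl in fm.
  have sh : size h = (m - d).+1.
    have := sf; rewrite fE size_monicM ?monic_neq0 // sg addSn /= => E.
    by rewrite -subSn // -E addKn.
  have hK : npolyp (m - d).+1 h = h :> {poly F} by rewrite npolypK ?sh.
  exists (npolyp (m - d).+1 h); last by apply: val_inj; rewrite /= phiE hK.
  rewrite !inE hK sh hm eqxx /=.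
  by rewrite -tf fE nextcoefM // addrAC subrr add0r.
rewrite !inE => /andP[/andP[/eqP sh hm] /eqP th ->].
rewrite phiE size_monicM ?monic_neq0 // sg sh monicMl // hm nextcoefM // th.
by rewrite addrC subrK eqxx dvdp_mulr // addSn addnS /= subnKC ?eqxx.
Qed.

(** * Distribution of the second coefficient over irreducibles *)

Lemma exists_monic_irreducible (F : finFieldType) (f : {poly F}) :
  (1 < size f)%N -> exists2 g : {poly F}, g %| f & g \is monic /\ irreducible_poly g.
Proof.
have [n] := ubnP (size f); elim: n f => // n IH f sfn sf.
have f0 : f != 0 by rewrite -size_poly_gt0 ltnW.
have [fi|] := boolP (irreducibleb f).
  have c0 : (lead_coef f)^-1 != 0 by rewrite invr_eq0 lead_coef_eq0.
  exists ((lead_coef f)^-1 *: f); first by rewrite dvdpZl.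
  split; first by rewrite monicE lead_coefZ mulVf // lead_coef_eq0.
  have [_ fP] := irreducibleP _ fi; split; first by rewrite size_scale.
  move=> h sh; rewrite dvdpZr // => hf.
  by apply: eqp_trans (fP h sh hf) _; rewrite eqp_sym eqp_scale.
rewrite /irreducibleb sf /= => /forallPn[h]; rewrite negb_imply -ltnNge.
rewrite -Pdiv.Idomain.dvdpE => /andP[hf sh].
have [|//|g gh gP] := IH h.
  by apply: leq_ltn_trans (size_npoly h) _; rewrite prednK ?(ltnW sf).
by exists g => //; apply: dvdp_trans hf.
Qed.

Lemma monic_irredsP (F : finFieldType) i (g : {poly_i.+1 F}) :
  reflect [/\ size g = i.+1, polyn g \is monic & irreducible_poly g]
          (g \in monic_irreds F i).
Proof.
rewrite !inE; apply: (iffP andP).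
  by move=> [/andP[/eqP ? ?] /irreducibleP].
by move=> [-> -> /irreducibleP]; rewrite eqxx.
Qed.

Lemma coprimep_irreducible (R : idomainType) (g h : {poly R}) :
  g \is monic -> h \is monic -> irreducible_poly g -> irreducible_poly h ->
  g != h -> coprimep g h.
Proof.
move=> gm hm gi hi; rewrite irreducible_poly_coprime //; apply: contra => gh.
rewrite -eqp_monic //; case: hi => _; apply=> //.
by case: gi => sg _; rewrite neq_ltn sg orbT.
Qed.

(** This is unique factorization read on degrees: the multiplicity of [P] in [f] is the number of
    positive exponents [k] with [P ^+ k] dividing [f]. Removing one irreducible factor [g] changes
    only the count at [P = g], by one. *)
Lemma degree_sum_irreducibles (F : finFieldType) N (f : {poly F}) :
  f \is monic -> (size f <= N.+1)%N ->
  (\sum_(i < N.+1) \sum_(P in monic_irreds F i) \sum_(k < N)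
     i * (polyn P ^+ k.+1 %| f)%R)%N = (size f).-1.
Proof.
have [n] := ubnP (size f); elim: n f => // n IH f sfn fm sfN.
have [sf|sf] := leqP (size f) 1.
  have f1 : f = 1.
    apply: monic_size1 => //; apply/eqP; rewrite eqn_leq sf.
    by rewrite size_poly_gt0 monic_neq0.
  rewrite f1 size_poly1 big1 // => i _.
  rewrite big1 // => P /monic_irredsP[sP Pm [sP' _]].
  rewrite big1 // => k _; rewrite dvdp1 -[size _]prednK ?size_exp; last first.
    by rewrite size_poly_gt0 monic_neq0 // rpredX.
  have i0 : (0 < i)%N by rewrite -ltnS -sP.
  by rewrite sP eqSS muln_eq0 /= (gtn_eqF i0) muln0.
have [g /dvdpP[h fE] [gm gi]] := exists_monic_irreducible sf.
have hm : h \is monic by rewrite fE monicMr in fm.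
have [d sg] : exists d, size g = d.+2.
  by case: gi => sg _; exists (size g).-2; case: (size g) sg => [|[]].
have sfE : size f = (d.+1 + size h)%N.
  by rewrite fE size_monicM ?monic_neq0 // sg addnS addnC.
have h1 : (0 < size h)%N by rewrite size_poly_gt0 monic_neq0.
have shN : (size h <= N)%N by move: sfN; rewrite sfE; lia.
have shn : (size h < n)%N by move: sfn; rewrite sfE; lia.
have dN : (d.+1 < N.+1)%N by lia.
have key i (P : {poly_i.+1 F}) : P \in monic_irreds F i ->
    (\sum_(k < N) i * (polyn P ^+ k.+1 %| f)%R =
     \sum_(k < N) i * (polyn P ^+ k.+1 %| h)%R + i * (polyn P == g)%R)%N.
  move=> /monic_irredsP[sP Pm Pi]; have [PE|Pg] := eqVneq (polyn P) g; last first.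
    rewrite muln0 addn0; apply: eq_bigr => k _; congr (_ * _)%N.
    by rewrite fE Gauss_dvdpl // coprimep_expl // coprimep_irreducible.
  rewrite muln1 PE fE; have {sP} id : i = d.+1 by move: sP; rewrite PE sg => -[].
  have N0 : (0 < N)%N by lia.
  (* The exponents shift by one: exponent 1 always divides [h * g], and exponent [k.+1] divides
     [h * g] when exponent [k] divides [h]. The exponent [N] left over for [h] counts 0, since [h]
     has degree below [N]. *)
  rewrite -(prednK N0) big_ord_recl [in RHS]big_ord_recr /= expr1.
  rewrite dvdp_mull // muln1 addnC; congr (_ + _)%N.
  have /negbTE-> : ~~ (g ^+ N.-1.+1 %| h).
    apply/negP => /dvdp_leq; rewrite monic_neq0 // => /(_ isT).
    move=> /leq_trans/(_ shN); rewrite -[size (g ^+ _)]prednK ?size_exp.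
      by rewrite sg prednK //=; have := leq_pmull N (ltn0Sn d); lia.
    by rewrite size_poly_gt0 monic_neq0 // rpredX.
  rewrite muln0 addn0; apply: eq_bigr => k _; congr (_ * _)%N.
  by rewrite [g ^+ _.+1]exprSr dvdp_mul2r // monic_neq0.
rewrite (eq_bigr (fun i : 'I_N.+1 => (\sum_(P in monic_irreds F i) \sum_(k < N)
    i * (polyn P ^+ k.+1 %| h)%R +
    \sum_(P in monic_irreds F i) i * (polyn P == g))%N)).
  rewrite big_split /= (IH h shn hm (leqW shN)).
  rewrite (bigD1 (Ordinal dN)) //= (bigD1 (npolyp d.+2 g)) /=; last first.
    by apply/monic_irredsP; rewrite npolypK ?sg.
  rewrite npolypK ?sg // eqxx muln1 big1; last first.
    move=> P /andP[_ Pg]; case: eqP => [PE|_]; last by rewrite muln0.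
    by case/eqP: Pg; apply: val_inj; rewrite /= npolypK ?sg.
  rewrite big1; first by rewrite sfE; case: (size h) h1 => // s _; lia.
  move=> i; rewrite -val_eqE /= => id; rewrite big1 // => P /monic_irredsP[sP _ _].
  case: eqP => [PE|_]; last by rewrite muln0.
  by case/eqP: id; move: sP; rewrite PE sg => -[].
by move=> i _; rewrite -big_split; apply: eq_bigr => P /key.
Qed.

Lemma big_divisors_ord (n N : nat) (G : nat -> nat) :
  (0 < n <= N)%N ->
  (\sum_(i <- divisors n) G i = \sum_(i < N.+1 | (i %| n)%N) G i)%N.
Proof.
move=> /andP[n0 nN]; rewrite -(big_mkord (fun i => i %| n)%N) -[RHS]big_filter.
apply: perm_big; apply: uniq_perm; rewrite ?divisors_uniq ?filter_uniq ?iota_uniq //.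
move=> i; rewrite mem_filter -dvdn_divisors // mem_index_iota ltnS leq0n /=.
by case: (boolP (i %| n)%N) => //= /(dvdn_leq n0)/leq_trans->.
Qed.

Lemma big_divisors_pairs (n N : nat) (G : nat -> nat -> nat) :
  (0 < n <= N)%N ->
  (\sum_(i < N.+1) \sum_(k < N) (i * k.+1 == n) * G i k.+1 =
   \sum_(i <- divisors n) G i (n %/ i))%N.
Proof.
move=> nN; rewrite (big_divisors_ord _ nN); case/andP: nN => n0 nN.
rewrite [RHS]big_mkcond; apply: eq_bigr => i _.
case: ifP => [/dvdnP[[|d] nE]|/negP din]; first by rewrite nE in n0.
  have i0 : (0 < i)%N by move: n0; rewrite nE; case: (i : nat) => //; rewrite muln0.
  have dN : (d < N)%N by apply: leq_trans nN; rewrite nE leq_pmulr.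
  rewrite (bigD1 (Ordinal dN)) //= nE mulnK // [(d.+1 * i)%N]mulnC eqxx mul1n.
  rewrite big1 ?addn0 // => k; rewrite -val_eqE /= => kd.
  by rewrite eqn_pmul2l // eqSS (negbTE kd).
rewrite big1 // => k _; case: eqP => // nE; case: din.
by rewrite -nE dvdn_mulr.
Qed.

(** Both sides add up the degrees of the monic [f] of degree [n] with second coefficient [t], on the
    right through the prime powers dividing [f]. A power of degree [n' < n] divides
    [#|F| ^ (n - n').-1] of them whatever [t] is; one of degree [n] must equal [f], which constrains
    its own second coefficient. *)
Lemma degree_count (F : finFieldType) (n : nat) (t : F) :
  (0 < n)%N ->
  (n * #|F| ^ n.-1 =
    \sum_(1 <= n' < n) #|F| ^ (n - n').-1 *
       \sum_(i <- divisors n') i * #|monic_irreds F i| +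
    \sum_(i <- divisors n)
      i * #|[set P in monic_irreds F i | nextcoef P *+ (n %/ i) == t]|)%N.
Proof.
move=> n0.
have -> : (n * #|F| ^ n.-1 =
    \sum_(f in [set f in monics F n | nextcoef f == t]) n)%N.
  by rewrite sum_nat_const card_monics_nextcoef mulnC -(prednK n0).
rewrite (eq_bigr (fun f : {poly_n.+1 F} =>
   \sum_(i < n.+1) \sum_(P in monic_irreds F i) \sum_(k < n)
     i * (polyn P ^+ k.+1 %| f)%R)%N); last first.
  move=> f; rewrite !inE => /andP[/andP[/eqP sf fm] _].
  by rewrite degree_sum_irreducibles ?sf.
rewrite exchange_big /=.
have count i (P : {poly_i.+1 F}) k : P \in monic_irreds F i -> (k < n)%N ->
    (\sum_(f in [set f in monics F n | nextcoef f == t])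
        i * (polyn P ^+ k.+1 %| polyn f)%R =
     \sum_(1 <= n' < n) (i * k.+1 == n') * (i * #|F| ^ (n - n').-1) +
     (i * k.+1 == n) * (i * (nextcoef P *+ k.+1 == t)))%N.
  move=> /monic_irredsP[sP Pm [sP' _]] kn.
  have i0 : (0 < i)%N by rewrite -ltnS -sP.
  have sPk : size (polyn P ^+ k.+1) = (i * k.+1).+1.
    rewrite -[size _]prednK ?size_exp ?sP //.
    by rewrite size_poly_gt0 monic_neq0 // rpredX.
  rewrite -big_distrr /= -big_mkcondr /= sum1dep_card.
  have -> : #|[set f : {poly_n.+1 F} |
      (f \in [set f in monics F n | nextcoef f == t]) &&
      (polyn P ^+ k.+1 %| polyn f)]| =
    #|[set f in monics F n | (nextcoef f == t) && (polyn P ^+ k.+1 %| polyn f)]|.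
    by apply: eq_card => f; rewrite !inE andbA.
  rewrite (card_monics_dvd _ _ _ sPk) ?rpredX // card_monics_nextcoef.
  rewrite nextcoefX //.
  have d0 : (0 < i * k.+1)%N by rewrite muln_gt0 i0.
  case: (ltngtP (i * k.+1) n) => [ltdn|ltnd|dn].
  - rewrite mul0n addn0 (bigD1_seq (i * k.+1)%N) ?iota_uniq ?mem_index_iota ?d0 //=.
    rewrite eqxx mul1n big1 ?addn0 => [|j]; last first.
      by rewrite eq_sym => /negbTE->.
    by move: ltdn; rewrite -subn_gt0; case: (n - _)%N.
  - rewrite mul0n addn0 muln0 big1_seq // => j; rewrite mem_index_iota.
    by case: eqP => // <- /andP[_ /andP[_ /ltn_trans/(_ ltnd)]]; rewrite ltnn.
  rewrite -dn subnn mul1n big1_seq ?add0n ?subr_eq0 1?eq_sym // => j.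
  by rewrite mem_index_iota dn; case: eqP => // <-; rewrite ltnn !andbF.
rewrite (eq_bigr (fun i : 'I_n.+1 => \sum_(k < n)
    (\sum_(1 <= n' < n) (i * k.+1 == n') *
         (#|F| ^ (n - n').-1 * (i * #|monic_irreds F i|)) +
     (i * k.+1 == n) *
        (i * #|[set P in monic_irreds F i | nextcoef P *+ k.+1 == t]|)))%N);
  last first.
  move=> i _; rewrite exchange_big /=.
  rewrite (eq_bigr (fun P : {poly_i.+1 F} => \sum_(k < n)
     (\sum_(1 <= n' < n) (i * k.+1 == n') * (i * #|F| ^ (n - n').-1) +
     (i * k.+1 == n) * (i * (nextcoef P *+ k.+1 == t))))%N); last first.
    move=> P Pi; rewrite exchange_big /=; apply: eq_bigr => k _.
    by rewrite count.
  rewrite exchange_big /=; apply: eq_bigr => k _.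
  rewrite big_split /=; congr (_ + _)%N.
    rewrite sum_nat_const big_distrr /=; apply: eq_bigr => n' _.
    rewrite mulnCA; congr (_ * _)%N; rewrite mulnCA [RHS]mulnCA; congr (_ * _)%N.
    exact: mulnC.
  rewrite -!big_distrr /= -big_mkcondr sum1dep_card; congr (_ * (_ * _))%N.
under eq_bigr => i _ do rewrite big_split /=.
rewrite big_split /=; congr (_ + _)%N; last first.
  apply: (big_divisors_pairs (fun i k =>
    i * #|[set P in monic_irreds F i | nextcoef P *+ k == t]|)%N).
  by rewrite n0 /=.
under eq_bigr => i _ do rewrite exchange_big /=.
rewrite exchange_big /=; rewrite big_seq_cond [RHS]big_seq_cond.
apply: eq_bigr => n' /andP[]; rewrite mem_index_iota => /andP[n'0 n'n] _.
rewrite big_distrr /=.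
apply: (big_divisors_pairs (fun i _ =>
  #|F| ^ (n - n').-1 * (i * #|monic_irreds F i|))%N).
by rewrite n'0 ltnW.
Qed.

Lemma sum_irreds_partition (F : finFieldType) (n : nat) :
  (\sum_(i <- divisors n) i * #|monic_irreds F i| =
   \sum_(u : F) \sum_(i <- divisors n)
      i * #|[set P in monic_irreds F i | nextcoef P *+ (n %/ i) == u]|)%N.
Proof.
rewrite exchange_big; apply: eq_bigr => i _; rewrite -big_distrr /=.
congr (_ * _)%N; rewrite -[LHS]sum1_card.
rewrite (partition_big (fun P : {poly_i.+1 F} => nextcoef P *+ (n %/ i)) xpredT) //=.
by apply: eq_bigr => u _; rewrite sum1dep_card.
Qed.

(** By strong induction each of the [n.-1] terms [n' < n] in [degree_count] is [#|F| ^ n.-1]; one of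
    the [n] copies on the left remains. *)
Lemma sum_irreds_nextcoef (F : finFieldType) (n : nat) (t : F) :
  (0 < n)%N ->
  (\sum_(i <- divisors n)
      i * #|[set P in monic_irreds F i | nextcoef P *+ (n %/ i) == t]| =
   #|F| ^ n.-1)%N.
Proof.
elim/ltn_ind: n t => n IH t n0; have := degree_count t n0.
have total n' : (0 < n' < n)%N ->
    (\sum_(i <- divisors n') i * #|monic_irreds F i| = #|F| ^ n')%N.
  move=> /andP[n'0 n'n].
  rewrite sum_irreds_partition.
  under eq_bigr => u _ do rewrite IH //.
  by rewrite sum_nat_const -expnS prednK.
rewrite (eq_big_nat _ _ (F2 := fun _ => #|F| ^ n.-1)%N).
  rewrite sum_nat_const_nat subn1 -{1}(prednK n0) mulSn addnC => /addnI.
  by move=> <-.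
move=> i /andP[i0 in']; rewrite total ?i0 // -expnD; congr (_ ^ _)%N; lia.
Qed.

Lemma sum_card_irreds (F : finFieldType) (n : nat) :
  (0 < n)%N ->
  (\sum_(i <- divisors n) i * #|monic_irreds F i| = #|F| ^ n)%N.
Proof.
move=> n0.
rewrite sum_irreds_partition.
under eq_bigr => u _ do rewrite sum_irreds_nextcoef //.
by rewrite sum_nat_const -expnS prednK.
Qed.

Definition irreds_nextcoef (F : finFieldType) (i : nat) (t : F) :=
  #|[set P in monic_irreds F i | nextcoef P == t]|.

(** * Solving for the distribution by Moebius inversion *)

Section Coefficients.
Variables (F : finFieldType) (p : nat).
Hypothesis pF : p \in [pchar F].
Let q := #|F|.

Lemma natr_card_neq0 : q%:R != 0 :> rat.
Proof. by rewrite pnatr_eq0 -lt0n /q (cardD1 0). Qed.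

Lemma a_coefE i : (0 < i)%N ->
  i%:R * (q%:R * a_coef p q i) =
  \sum_(k <- divisors i | ~~ (p %| k)%N) (moebius k)%:~R * q%:R ^+ (i %/ k)%N.
Proof.
move=> i0; rewrite /a_coef mulrA -natrM mulVKf //.
by rewrite natrM mulf_neq0 ?natr_card_neq0 // pnatr_eq0 -lt0n.
Qed.

(** Gauss's formula for [#|I_i|], with its Moebius sum split according to whether [p] divides
    [k]. *)
Lemma card_irreds_coef i : (0 < i)%N ->
  #|monic_irreds F i|%:R = q%:R * a_coef p q i + b_coef p q i.
Proof.
move: i; apply: (divisor_sum_inj (chi := xpredT)) => // n n0.
transitivity (q%:R ^+ n : rat).
  rewrite -natrX -sum_card_irreds // natr_sum.
  by apply: eq_bigr => i _; rewrite natrM.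
rewrite -[LHS](moebius_inversion (chi := xpredT) (fun n => q%:R ^+ n) _ _ n0) //.
rewrite big_seq [RHS]big_seq; apply: eq_bigr => i.
rewrite -dvdn_divisors // => /(dvdn_gt0 n0) i0.
rewrite mulrDr a_coefE // /b_coef mulVKf ?pnatr_eq0 -?lt0n //.
by rewrite addrC [LHS](bigID (fun k => p %| k)%N).
Qed.

(** For nonzero [t] the sum in [sum_irreds_nextcoef] keeps only the [i] with [n %/ i] prime to [p],
    and there the condition can be divided by [n %/ i], leaving a nonzero value. The [a_i] satisfy
    the same triangular system. *)
Lemma a_coef_irreds (t : F) i : t != 0 -> (0 < i)%N ->
  (irreds_nextcoef i t)%:R = a_coef p q i.
Proof.
move=> t0; have pp := pcharf_prime pF.
pose chi k := ~~ (p %| k)%N.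
have chi1 : chi 1%N by rewrite /chi dvdn1 gtn_eqF // prime_gt1.
have chiM : {morph chi : a b / (a * b)%N >-> a && b}.
  by move=> a b; rewrite /chi Euclid_dvdM // negb_or.
elim/ltn_ind: i t t0 => n IH t t0 n0.
have n0' : n%:R != 0 :> rat by rewrite pnatr_eq0 -lt0n.
(* If [p] divides [n %/ i], the quotient takes the default value 0, but [chi] excludes these [i]
   from the sums below. *)
pose u i : rat := q%:R * (i * irreds_nextcoef i (t / (n %/ i)%:R))%:R.
have Eu : \sum_(i <- divisors n | chi (n %/ i)%N) u i = q%:R ^+ n.
  have -> : q%:R ^+ n = q%:R * (q ^ n.-1)%:R :> rat.
    by rewrite natrX -exprS prednK.
  rewrite -(sum_irreds_nextcoef t n0) natr_sum mulr_sumr [LHS]big_mkcond.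
  apply: eq_bigr => i _; rewrite /u /=.
  case: ifP => [chii|/negbFE pi].
    congr (_ * (_ * _)%:R); apply: eq_card => P; rewrite !inE.
    congr (_ && _); rewrite -[nextcoef P *+ _]mulr_natr.
    have c0 : (n %/ i)%:R != 0 :> F by rewrite -(dvdn_pcharf pF).
    by apply/eqP/eqP => [->|<-]; rewrite ?divfK ?mulfK.
  (* Here [n %/ i] is zero in [F], so the nonzero [t] is never reached. *)
  rewrite eq_card0 ?muln0 ?mulr0 // => P; rewrite !inE -[nextcoef P *+ _]mulr_natr.
  have /eqP-> : (n %/ i)%:R == 0 :> F by rewrite -(dvdn_pcharf pF).
  by rewrite mulr0 [0 == t]eq_sym (negbTE t0) andbF.
have Ea : \sum_(i <- divisors n | chi (n %/ i)%N)
    i%:R * (q%:R * a_coef p q i) = q%:R ^+ n.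
  rewrite -[RHS](moebius_inversion (fun n => q%:R ^+ n) chi1 chiM n0).
  rewrite big_seq_cond [RHS]big_seq_cond; apply: eq_bigr => i.
  by rewrite -dvdn_divisors // => /andP[/(dvdn_gt0 n0) i0 _]; rewrite a_coefE.
move: Eu; rewrite -Ea big_mkcond [RHS]big_mkcond.
rewrite !(bigD1_seq n) ?divisors_uniq ?divisors_id //= divnn n0 chi1.
rewrite big_seq_cond (eq_bigr (fun i => if chi (n %/ i)%N
   then i%:R * (q%:R * a_coef p q i) else 0)).
  rewrite -big_seq_cond => /addIr; rewrite /u divnn n0 divr1 natrM mulrCA.
  by move=> /(mulfI n0')/(mulfI natr_card_neq0).
move=> i /andP[]; rewrite -dvdn_divisors // => din nin; have i0 := dvdn_gt0 n0 din.
have ltin : (i < n)%N by rewrite ltn_neqAle nin (dvdn_leq n0 din).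
case: ifP => // chii; rewrite /u natrM mulrCA (IH i ltin) //.
by rewrite mulf_neq0 // invr_eq0 -(dvdn_pcharf pF).
Qed.

(** The value 0 gets what the [q - 1] nonzero values leave of [#|I_i| = q * a_i + b_i]. *)
Lemma irreds_nextcoefE (t : F) i : (0 < i)%N ->
  (irreds_nextcoef i t)%:R = a_coef p q i + (t == 0)%:R * b_coef p q i.
Proof.
move=> i0; have [->|t0] := eqVneq t 0; last by rewrite a_coef_irreds // mul0r addr0.
have := card_irreds_coef i0.
have -> : #|monic_irreds F i| = (\sum_(t : F) irreds_nextcoef i t)%N.
  rewrite -[LHS]sum1_card.
  rewrite (partition_big (fun P : {poly_i.+1 F} => nextcoef P) xpredT) //=.
  by apply: eq_bigr => u _; rewrite sum1dep_card.
rewrite natr_sum (bigD1 0) //= (eq_bigr (fun _ => a_coef p q i)); last first.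
  by move=> u u0; rewrite a_coef_irreds.
have := cardC1 (0 : F).
rewrite sumr_const => ->.
have : q%:R = q.-1%:R + 1 :> rat by rewrite natr1 prednK // /q (cardD1 0).
rewrite -[a_coef _ _ _ *+ _]mulr_natl => ->; rewrite mul1r mulrDl mul1r => E.
move: E; rewrite -/q; move: (_ * a_coef p q i) => z; lra.
Qed.

End Coefficients.

(** * Additive characters and the coefficients A_k *)

(** The additive group of [F] is abelian with at least two elements, so it has a linear character
    other than the principal one. *)
Lemma exists_additive_char (F : finFieldType) :
  exists psi : F -> algC,
    [/\ {morph psi : x y / x + y >-> x * y}, psi 0 = 1 & exists t, psi t != 1].
Proof.
have ab : abelian [set: F] by apply: FinRing.zmod_abelian.
have nc : (1 < Nirr [set: F])%N.
  rewrite NirrE; move: ab; rewrite card_classes_abelian => /eqP->.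
  by rewrite cardsT (cardD1 0) (cardD1 1) !inE oner_eq0.
pose i : Iirr [set: F] := cast_ord (prednK (ltnW nc)) (inord 1).
have i0 : i != 0.
  by rewrite -val_eqE /= inordK // -ltnS prednK // ltnW.
have li : 'chi_i \is a linear_char by apply/char_abelianP.
exists 'chi_i; split=> [x y||].
- by rewrite -(lin_charM li) ?inE.
- exact: lin_char1 li.
apply/existsP; rewrite -[X in is_true X]negbK negb_exists.
apply/negP => /forallP chi1; case/eqP: i0; apply/eqP.
rewrite -irr_eq1; apply/eqP/cfunP => x; rewrite cfun1E inE.
by apply/eqP; move: (chi1 x); rewrite negbK.
Qed.

(** * Generalized binomials and the expansion of (1 - (-X)^p)^N (1 + X)^s *)

Lemma gbinom0 (x : rat) : gbinom x 0 = 1.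
Proof. by rewrite /gbinom big_ord0 fact0 divr1. Qed.

Lemma gbinomS (x : rat) k : gbinom (x + 1) k.+1 = gbinom x k.+1 + gbinom x k.
Proof.
rewrite /gbinom big_ord_recl [X in _ = X / _ + _]big_ord_recr /= factS natrM.
under eq_bigr => i _ do rewrite /bump add1n -natr1 opprD addrACA subrr addr0.
have f0 : k`!%:R != 0 :> rat by rewrite pnatr_eq0 -lt0n fact_gt0.
have k0 : k.+1%:R != 0 :> rat by rewrite pnatr_eq0.
rewrite subr0; move: k0; rewrite -natr1 => k0; field; exact/andP.
Qed.

Lemma gbinom_nat (n k : nat) : gbinom n%:R k = 'C(n, k)%:R.
Proof.
elim: n k => [|n IH] [|k]; rewrite ?gbinom0 ?bin0 //.
  by rewrite /gbinom big_ord_recl subr0 !mul0r bin0n.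
by rewrite -natr1 gbinomS !IH binS natrD.
Qed.

(* The coefficients of (1 - (-X)^p)^N (1 + X)^s; the two cases of [A_coef] are
   instances of this single formula. *)
Definition B_coef (p : nat) (N s : rat) (k : nat) : rat :=
  \sum_(j < (k %/ p).+1) gbinom N j * gbinom s (k - p * j)%N * (-1) ^+ (j + p * j).

(** A summation range independent of [k] lets the sums for [k] and [k.+1] be compared term by
    term. *)
Lemma B_coefE p N s k M : (0 < p)%N -> (k <= M)%N ->
  B_coef p N s k = \sum_(j < M.+1 | (p * j <= k)%N)
     gbinom N j * gbinom s (k - p * j)%N * (-1) ^+ (j + p * j).
Proof.
move=> p0 kM; rewrite /B_coef.
rewrite (big_ord_widen M.+1 (fun j =>
  gbinom N j * gbinom s (k - p * j)%N * (-1) ^+ (j + p * j))).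
  by apply: eq_bigl => j; rewrite ltnS leq_divRL // mulnC.
by rewrite ltnS (leq_trans (leq_div _ _)).
Qed.

Lemma B_coef0 p N s : B_coef p N s 0 = 1.
Proof.
by rewrite /B_coef div0n big_ord_recl big_ord0 addr0 muln0 !gbinom0 !mul1r.
Qed.

(** Pascal's rule in [s], that is, the effect of one more factor 1 + X. *)
Lemma B_coefS p N s k : (0 < p)%N ->
  B_coef p N (s + 1) k.+1 = B_coef p N s k.+1 + B_coef p N s k.
Proof.
move=> p0; rewrite !(B_coefE _ _ p0 (leqnn k.+1)) (B_coefE _ _ p0 (leqnSn k)).
rewrite [LHS]big_mkcond [X in _ = X + _]big_mkcond [X in _ = _ + X]big_mkcond.
rewrite -big_split /=; apply: eq_bigr => j _.
case: (ltngtP (p * j)%N k.+1) => [lt_jk|lt_kj|->].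
- by rewrite -ltnS lt_jk subSn // gbinomS mulrDr mulrDl.
- by rewrite leqNgt (leq_trans _ lt_kj) //= addr0.
(* At [p * j = k.+1] both binomials in [s] have lower index 0, and the sum for [k] has no such
   term. *)
- by rewrite ltnn subnn !gbinom0 addr0.
Qed.

(** [gbinom 0] vanishes at positive lower index, so only [p * j = k] contributes; this recovers the
    separate case of [A_coef] at [b = 0]. *)
Lemma B_coef_s0 p N k : (0 < p)%N ->
  B_coef p N 0 k =
    if (p %| k)%N then gbinom N (k %/ p)%N * (-1) ^+ (k + k %/ p) else 0.
Proof.
move=> p0; have z j : (0 < j)%N -> gbinom 0 j = 0.
  by case: j => // j _; rewrite -[0 in LHS](mulr0n 1) gbinom_nat.
case: ifP => [/dvdnP[d ->]|/negP pk]; last first.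
  rewrite /B_coef big1 // => j _; rewrite z ?mulr0 ?mul0r //.
  rewrite subn_gt0 ltn_neqAle mulnC -leq_divRL // -ltnS ltn_ord andbT.
  by apply/eqP => kE; apply: pk; rewrite -kE dvdn_mull.
rewrite /B_coef mulnK // big_ord_recr /= mulnC subnn gbinom0 mulr1 addrC.
rewrite big1 ?addr0 ?[(d + _)%N]addnC // => j _.
by rewrite z ?mulr0 ?mul0r // subn_gt0 ltn_pmul2l.
Qed.

Lemma A_coefE p q k a b : (0 < p)%N ->
  A_coef p q k a b = B_coef p (a * q%:R / p%:R) b k.
Proof.
by move=> p0; rewrite /A_coef; case: eqP => [->|] //=; rewrite B_coef_s0.
Qed.

Lemma coef_one_sub_exp (R : comNzRingType) p N k : (0 < p)%N ->
  ((1 - (- 'X) ^+ p : {poly R}) ^+ N)`_k =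
    if (p %| k)%N then 'C(N, k %/ p)%:R * (-1) ^+ (k + k %/ p) else 0.
Proof.
move=> p0; rewrite exprBn coef_sum.
have cE (i : 'I_N.+1) :
    (((-1) ^+ i * 1 ^+ (N - i) * (- 'X : {poly R}) ^+ p ^+ i) *+ 'C(N, i))`_k =
    if k == (p * i)%N then 'C(N, i)%:R * (-1) ^+ (p * i + i) else 0.
  rewrite expr1n mulr1 -exprM [(- 'X) ^+ _]exprNn mulrA -exprD coefMn.
  have -> : (-1) ^+ (i + p * i) = ((-1) ^+ (i + p * i))%:P :> {poly R}.
    by rewrite rmorphXn rmorphN1.
  rewrite coefCM coefXn addnC; case: eqP => _; last by rewrite mulr0 mul0rn.
  by rewrite mulr1 mulr_natl.
under eq_bigr => i _ do rewrite cE.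
rewrite -big_mkcond; case: ifP => [/dvdnP[d ->]|/negP pk]; last first.
  by rewrite big1 // => i /eqP kE; case: pk; rewrite kE dvdn_mulr.
have dE i : (d * p == p * i)%N = (i == d) by rewrite mulnC eqn_pmul2l // eq_sym.
rewrite mulnK //; case: (leqP d N) => [dN|Nd].
  rewrite (big_pred1 (inord d)) ?inordK // => [|i].
    by rewrite [(p * d)%N]mulnC.
  by rewrite /= dE -val_eqE /= inordK.
rewrite bin_small // mul0r big1 // => i.
by rewrite dE => /eqP iE; have := ltn_ord i; rewrite iE ltnNge Nd.
Qed.

Lemma B_coef_poly p N z k : (0 < p)%N ->
  ((1 - (- 'X) ^+ p) ^+ N * (1 + 'X) ^+ z : {poly algC})`_k =
    ratr (B_coef p N%:R z%:R k).
Proof.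
move=> p0; elim: z k => [|z IH] k.
  rewrite mulr1 coef_one_sub_exp // B_coef_s0 //; case: ifP => _.
    by rewrite gbinom_nat rmorphM rmorph_sign /= ratr_nat.
  by rewrite rmorph0.
rewrite exprSr mulrA mulrDr mulr1 coefD coefMX; case: k => [|k] /=.
  by rewrite addr0 IH !B_coef0.
by rewrite !IH -natr1 B_coefS // rmorphD.
Qed.

(* The exponent s may be negative: multiplying by a power of 1 + X leads back to
   a natural exponent. *)
Lemma B_coef_descent p N s a (E : {poly algC}) : (0 < p)%N ->
  (forall k, (E * (1 + 'X) ^+ a)`_k = ratr (B_coef p N (s + a%:R) k)) ->
  forall k, E`_k = ratr (B_coef p N s k).
Proof.
move=> p0; elim: a s E => [|a IH] s E EB k.
  by have := EB k; rewrite mulr1 addr0.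
have {IH} ES : forall k, (E * (1 + 'X))`_k = ratr (B_coef p N (s + 1) k).
  by apply: IH => j; rewrite -mulrA -exprS EB -addrA nat1r.
elim: k => [|k IHk]; have := ES _; rewrite mulrDr mulr1.
  by move=> /(_ 0); rewrite coefD coefMX addr0 !B_coef0.
by move=> /(_ k.+1); rewrite coefD coefMX IHk B_coefS // rmorphD /= => /addIr.
Qed.

Lemma poly_ext_algC (f g : {poly algC}) : (forall x, f.[x] = g.[x]) -> f = g.
Proof.
move=> fg; apply/subr0_eq.
(* In characteristic 0 these are distinct roots of [f - g], as many as its size and hence more than
   its degree. *)
pose s : seq algC := [seq i%:R | i <- iota 0 (size (f - g))].
apply: (@roots_geq_poly_eq0 _ _ s); rewrite ?size_map ?size_iota //.
- by apply/allP => x _; rewrite /root !hornerE fg subrr.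
- by rewrite map_inj_uniq ?iota_uniq //; exact: (mulrIn (oner_neq0 _)).
Qed.

(** At a nonzero [x], evaluate the factorization of X^p - 1 at [- x^-1] and multiply each of the [p]
    factors by [- x]. *)
Lemma prod_one_add_prim_root p (w : algC) : p.-primitive_root w ->
  \prod_(k < p) (1 + (w ^+ k) *: 'X) = 1 - (- 'X) ^+ p :> {poly algC}.
Proof.
move=> wp; have p0 := prim_order_gt0 wp; apply: poly_ext_algC => x.
rewrite horner_prod !hornerE.
under eq_bigr => k _ do rewrite !hornerE.
have [->|x0] := eqVneq x 0.
  rewrite oppr0 expr0n gtn_eqF // subr0 big1 // => k _.
  by rewrite mulr0 addr0.
have := congr1 (horner^~ (- x^-1)) (factor_Xn_sub_1 wp).
rewrite /= big_mkord horner_prod !hornerE => E.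
transitivity ((- x) ^+ p * ((- x^-1) ^+ p - 1)).
  rewrite -E -[X in _ = _ ^+ X * _](card_ord p) -prodr_const -big_split /=.
  by apply: eq_bigr => k _; rewrite !hornerE; field.
by rewrite mulrBr mulr1 -exprMn mulrNN mulfV // expr1n.
Qed.

(** * Products over a nontrivial additive character *)

Section AdditiveCharacter.
Variables (F : finFieldType) (p : nat).
Hypothesis pF : p \in [pchar F].
Let q := #|F|.
Variable psi : F -> algC.
Hypothesis psiD : {morph psi : x y / x + y >-> x * y}.
Hypothesis psi0 : psi 0 = 1.
Variable t0 : F.
Hypothesis psi_t0 : psi t0 != 1.

Lemma psiMn x n : psi (x *+ n) = psi x ^+ n.
Proof. by elim: n => [|n IH]; rewrite ?mulr0n // mulrS psiD IH exprS. Qed.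

Lemma psi_p x : psi x ^+ p = 1.
Proof. by rewrite -psiMn -mulr_natr (pcharf0 pF) mulr0. Qed.

(** Translation by [t0] multiplies the sum by [psi t0], which is not 1. *)
Lemma sum_psi : \sum_x psi x = 0.
Proof.
have E : psi t0 * \sum_x psi x = \sum_x psi x.
  rewrite mulr_sumr [RHS](reindex_inj (addrI t0)).
  by apply: eq_bigr => x _; rewrite psiD.
apply/eqP; move/eqP: E; rewrite -subr_eq0 -[X in _ - X]mul1r -mulrBl mulf_eq0.
by rewrite subr_eq0 (negbTE psi_t0).
Qed.

Lemma psi_orthogonality x : \sum_c psi (c * x) = (q * (x == 0))%:R.
Proof.
have [->|x0] := eqVneq x 0.
  by under eq_bigr => c _ do rewrite mulr0 psi0; rewrite sumr_const muln1.
transitivity (\sum_y psi y); last by rewrite sum_psi muln0.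
by rewrite [RHS](reindex_inj (mulIf x0)).
Qed.

(** The values of [psi] are the [p]-th roots of unity, and its fibres are translates of one another,
    so each root is taken [q / p] times. *)
Lemma prod_psi :
  (p %| q)%N /\
  \prod_t (1 + psi t *: 'X) = (1 - (- 'X) ^+ p) ^+ (q %/ p)%N :> {poly algC}.
Proof.
have pp := pcharf_prime pF.
(* The order of [psi t0] divides the prime [p] and is not 1. *)
have wp : p.-primitive_root (psi t0).
  have [m mw mp] := prim_order_exists (prime_gt0 pp) (psi_p t0).
  have /primeP[_ /(_ m mp)/orP[/eqP m1|/eqP<-//]] := pp.
  move: mw psi_t0; rewrite m1 => /prim_expr_order.
  by rewrite expr1 => ->; rewrite eqxx.
pose n (k : 'I_p) := #|[set t | psi t == psi t0 ^+ k]|.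
pose k0 : 'I_p := Ordinal (prime_gt0 pp).
have nE k : n k = n k0.
  (* The fibre over [psi t0 ^+ k] is the fibre over 1 translated by [t0 *+ k]. *)
  rewrite /n -[RHS](card_imset _ (addrI (t0 *+ k))); apply: eq_card => t.
  apply/idP/imsetP => [|[u]]; rewrite !inE.
    move=> /eqP tE; exists (t - t0 *+ k); last by rewrite addrC subrK.
    rewrite !inE /= expr0; have := psiD (t - t0 *+ k) (t0 *+ k).
    rewrite subrK psiMn tE => /esym; rewrite -[RHS]mul1r => /mulIf->//.
    by rewrite expf_neq0 // (prim_root_eq0 wp) gtn_eqF // prime_gt0.
  by move=> /eqP uE ->; rewrite psiD psiMn uE mulr1.
have partE (R : Type) (idx : R) (op : Monoid.com_law idx) (f : F -> R) :
   \big[op/idx]_t f t =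
   \big[op/idx]_(k < p) \big[op/idx]_(t | psi t == psi t0 ^+ k) f t.
  rewrite (partition_big (fun t => sval (prim_rootP wp (psi_p t))) xpredT) //=.
  apply: eq_bigr => k _; apply: eq_bigl => t.
  case: (prim_rootP _ _) => j tE /=; rewrite tE.
  by rewrite (eq_prim_root_expr wp) !modn_small // .
have qE : q = (p * n k0)%N.
  rewrite /q -sum1_card partE /=.
  under eq_bigr => k _ do rewrite sum1dep_card -/(n k) nE.
  by rewrite sum_nat_const card_ord.
rewrite qE dvdn_mulr // mulKn ?prime_gt0 //; split=> //.
rewrite partE /= -(prod_one_add_prim_root wp) -prodrXl.
apply: eq_bigr => k _; rewrite -(nE k) /n.
rewrite (eq_bigr (fun _ => 1 + psi t0 ^+ k *: 'X)) => [|t /eqP->//].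
by rewrite prodr_const cardsE.
Qed.

(** Grouped by second coefficient, the product has exponent [a] at each nonzero [t] and
    [z = a + b_i] at 0. An extra factor [(1 + 'X) ^+ a] completes the product over all [t] to the
    power [a] and leaves [(1 + 'X) ^+ z] with natural exponent; [B_coef_descent] then removes it. *)
Lemma coef_prod_irreds i k : (0 < i)%N ->
  (\prod_(P in monic_irreds F i) (1 + psi (nextcoef P) *: 'X))`_k =
    ratr (A_coef p q k (a_coef p q i) (b_coef p q i)).
Proof.
move=> i0; have p0 := prime_gt0 (pcharf_prime pF).
have [pq prodE] := prod_psi.
pose a := irreds_nextcoef i (1 : F); pose z := irreds_nextcoef i (0 : F).
have aE : a%:R = a_coef p q i by apply: (a_coef_irreds pF); rewrite ?oner_eq0.
have zE : z%:R = a_coef p q i + b_coef p q i.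
  by rewrite [LHS](irreds_nextcoefE pF) // eqxx mul1r.
have tE (t : F) : t != 0 -> irreds_nextcoef i t = a.
  move=> t0'; apply/eqP; rewrite -(eqr_nat rat) aE; apply/eqP.
  exact: (a_coef_irreds pF).
rewrite A_coefE //; move: k; apply: (B_coef_descent (a := a)) => // k.
have -> :
  \prod_(P in monic_irreds F i) (1 + psi (nextcoef P) *: 'X) * (1 + 'X) ^+ a =
  (1 - (- 'X) ^+ p) ^+ (q %/ p * a) * (1 + 'X) ^+ z :> {poly algC}.
  rewrite (partition_big (fun P : {poly_i.+1 F} => nextcoef P) xpredT) //=.
  rewrite (eq_bigr (fun t => (1 + psi t *: 'X) ^+ irreds_nextcoef i t)); last first.
    move=> t _.
    rewrite (eq_bigr (fun _ => 1 + psi t *: 'X)) => [|P /andP[_ /eqP->]//].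
    rewrite prodr_const; congr (_ ^+ _); apply: eq_card => P.
    by rewrite unfold_in !inE.
  rewrite exprM -prodE (bigD1 0) //= [X in _ = X ^+ a * _](bigD1 0) //=.
  rewrite psi0 scale1r (eq_bigr (fun t => (1 + psi t *: 'X) ^+ a)) => [|t /tE->//].
  rewrite prodrXl exprMn [LHS]mulrC [_ ^+ z * _]mulrC mulrA; congr (_ * _ * _).
rewrite B_coef_poly //; congr (ratr (B_coef _ _ _ _)).
  rewrite natrM mulrC aE -mulrA; congr (_ * _).
  have p0' : p%:R != 0 :> rat by rewrite pnatr_eq0 gtn_eqF.
  by apply: (canRL (mulfK p0')); rewrite -natrM divnK.
by rewrite addrC aE zE.
Qed.

End AdditiveCharacter.

(** * Families of irreducible polynomials *)

Lemma coprimep_prodr (R : idomainType) (I : Type) (s : seq I) (P : pred I)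
    (g : I -> {poly R}) (f : {poly R}) :
  (forall i, P i -> coprimep f (g i)) -> coprimep f (\prod_(i <- s | P i) g i).
Proof.
move=> fg; apply: (big_rec (coprimep f)); first exact: coprimep1.
by move=> i x Pi fx; rewrite coprimepMr fg.
Qed.

Lemma dvdp_prod_coprime (R : idomainType) (I : eqType) (s : seq I) (P : pred I)
    (g : I -> {poly R}) (f : {poly R}) :
  uniq s ->
  (forall i j, P i -> P j -> i != j -> coprimep (g i) (g j)) ->
  (\prod_(i <- s | P i) g i %| f) = all (fun i => P i ==> (g i %| f)) s.
Proof.
move=> + cop; elim: s => [|i s IH] /=; first by rewrite big_nil dvd1p.
move=> /andP[is_ us]; rewrite big_cons; case: (boolP (P i)) => /= Pi; last exact: IH.
rewrite Gauss_dvdp ?IH // big_seq_cond; apply: coprimep_prodr => j /andP[js Pj].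
by apply: cop => //; apply: contraNneq is_ => ->.
Qed.

Section Families.
Variables (F : finFieldType) (I : finType) (d : I -> nat) (N : nat).
Hypothesis d_inj : injective d.
Hypothesis dN : forall i, (d i <= N)%N.
Let U : finType := {poly_N.+1 F}.

(* The irreducibles of degree [d i], moved into one type that does not depend on
   [i]. *)
Definition wide_irreds i : {set U} :=
  [set npolyp N.+1 (polyn P) | P in monic_irreds F (d i)].

Lemma wide_irredsK i (P : {poly_(d i).+1 F}) :
  npolyp N.+1 (polyn P) = polyn P :> {poly F}.
Proof. by rewrite npolypK // (leq_trans (size_npoly P)) // ltnS. Qed.

Lemma wide_irreds_inj i :
  injective (fun P : {poly_(d i).+1 F} => npolyp N.+1 (polyn P)).
Proof.
by move=> P Q /(congr1 (@polyn _ _)); rewrite !wide_irredsK => /val_inj.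
Qed.

Lemma wide_irredsP i (P : U) : P \in wide_irreds i ->
  [/\ size P = (d i).+1, polyn P \is monic & irreducible_poly P].
Proof. by move=> /imsetP[Q /monic_irredsP[sQ Qm Qi] ->]; rewrite wide_irredsK. Qed.

Lemma card_wide_irreds i : #|wide_irreds i| = #|monic_irreds F (d i)|.
Proof. exact: card_imset (@wide_irreds_inj i). Qed.

Lemma big_wide_irreds (R : Type) (idx : R) (op : Monoid.com_law idx) i
    (g : {poly F} -> R) :
  \big[op/idx]_(P in wide_irreds i) g (polyn P) =
  \big[op/idx]_(P in monic_irreds F (d i)) g (polyn P).
Proof.
rewrite big_imset => [|P Q _ _ /wide_irreds_inj //].
by apply: eq_bigr => P _; rewrite wide_irredsK.
Qed.

Lemma nb_irred_factors_wide i (f : {poly F}) :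
  nb_irred_factors (d i) f = #|[set P in wide_irreds i | polyn P %| f]|.
Proof.
rewrite -[RHS]sum1dep_card.
rewrite big_mkcondr /= (big_wide_irreds _ _ (fun P => if P %| f then 1%N else 0%N)).
by rewrite -big_mkcondr /= sum1dep_card.
Qed.

Definition families (k : I -> nat) : {set {ffun I -> {set U}}} :=
  [set S : {ffun I -> {set U}} |
     [forall i, (S i \subset wide_irreds i) && (#|S i| == k i)]].

Definition family_prod (S : {ffun I -> {set U}}) : {poly F} :=
  \prod_i \prod_(P in S i) polyn P.

Section Family.
Variables (k : I -> nat) (S : {ffun I -> {set U}}).
Hypothesis Sk : S \in families k.

Lemma familiesP i P : P \in S i ->
  [/\ size P = (d i).+1, polyn P \is monic & irreducible_poly P].
Proof.
by move: Sk; rewrite inE => /forallP/(_ i)/andP[/subsetP Si _] /Si/wide_irredsP.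
Qed.

Lemma family_card i : #|S i| = k i.
Proof. by move: Sk; rewrite inE => /forallP/(_ i)/andP[_ /eqP]. Qed.

Lemma family_prod_monic : family_prod S \is monic.
Proof. by apply: monic_prod => i _; apply: monic_prod => P /familiesP[]. Qed.

Lemma nextcoef_family : nextcoef (family_prod S) = \sum_i \sum_(P in S i) nextcoef P.
Proof.
rewrite nextcoef_prod => [|i _]; last by apply: monic_prod => P /familiesP[].
by apply: eq_bigr => i _; rewrite nextcoef_prod // => P /familiesP[].
Qed.

Lemma size_family : size (family_prod S) = (\sum_i d i * k i).+1.
Proof.
rewrite /family_prod size_prod => [|i _]; last first.
  by apply/prodf_neq0 => P /familiesP[_ Pm _]; rewrite monic_neq0.
rewrite (eq_bigr (fun i => (d i * k i).+1)) => [|i _].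
  rewrite -(eq_bigr _ (fun i _ => addn1 (d i * k i))) big_split /=.
  by rewrite sum1_card subSn ?leq_addl // addnK.
rewrite size_prod => [|P /familiesP[_ Pm _]]; last by rewrite monic_neq0.
rewrite (eq_bigr (fun _ => (d i).+1)) => [|P /familiesP[->]//].
by rewrite sum_nat_const family_card mulnS subSn ?leq_addr // addKn mulnC.
Qed.

(** The members of a family are pairwise coprime: within one index they are distinct irreducibles,
    and across indices their degrees differ by injectivity of [d]. *)
Lemma dvdp_family (f : {poly F}) :
  (family_prod S %| f) = [forall i, S i \subset [set P | polyn P %| f]].
Proof.
have cop i P j Q : P \in S i -> Q \in S j -> (i != j) || (P != Q) ->
    coprimep (polyn P) (polyn Q).
  move=> /familiesP[sP Pm Pi] /familiesP[sQ Qm Qi] ne.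
  apply: coprimep_irreducible => //.
  apply: contraTneq ne => PQ; rewrite negb_or !negbK.
  rewrite -(inj_eq d_inj) -(inj_eq val_inj) /= PQ eqxx andbT.
  by rewrite -eqSS -sP -sQ PQ.
rewrite /family_prod dvdp_prod_coprime ?index_enum_uniq //; last first.
  move=> i j _ _ ij; apply: coprimep_prodr => Q Qj; rewrite coprimep_sym.
  by apply: coprimep_prodr => P Pi; rewrite coprimep_sym (cop i P j Q) ?ij.
rewrite (eq_all (a2 := fun i => S i \subset [set P | polyn P %| f])).
  by apply/allP/forallP => H i //; apply: H; rewrite mem_index_enum.
move=> i /=; rewrite dvdp_prod_coprime ?index_enum_uniq //; last first.
  by move=> P Q Pi Qi PQ; rewrite (cop i P i Q) ?PQ ?orbT.
apply/allP/subsetP => [H P Pi|H P _].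
  by have := H P (mem_index_enum P); rewrite Pi inE.
by apply/implyP => /H; rewrite inE.
Qed.

End Family.
End Families.

Lemma coef_prod_one_add (R : comNzRingType) (U : finType) (J : {set U})
    (w : U -> R) k :
  (\prod_(P in J) (1 + w P *: 'X))`_k =
    \sum_(S : {set U} | (S \subset J) && (#|S| == k)) \prod_(P in S) w P.
Proof.
rewrite big_mkcond.
(* Factors outside [J] are written 0 + 1, so that the expansion runs over all subsets of [U]; those
   not inside [J] contribute 0. *)
rewrite (eq_bigr (fun P => (if P \in J then w P *: 'X else 0) + 1)); last first.
  by move=> P _; case: ifP => _; rewrite ?add0r // addrC.
rewrite bigA_distr coef_sum big_mkcond [RHS]big_mkcond; apply: eq_bigr => S _ /=.
rewrite -big_mkcond /=.
case: (boolP (S \subset J)) => [/subsetP SJ|/subsetPn[P PS PJ]].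
  rewrite (eq_bigr (fun P => w P *: 'X)) => [|P /SJ->//].
  rewrite scaler_prod prodr_const coefZ coefXn eq_sym.
  by rewrite /=; case: ifP => _; rewrite ?mulr1 ?mulr0.
by rewrite (bigD1 P) //= (negbTE PJ) mul0r coef0.
Qed.

(** * Counting families with a prescribed second coefficient *)

Section Count.
Variables (F : finFieldType) (I : finType) (d : I -> nat) (N : nat).
Hypothesis d_inj : injective d.
Hypothesis dN : forall i, (d i <= N)%N.
Let q := #|F|.
Local Notation J := (wide_irreds F d N).
Local Notation families := (families F d N).

Lemma families_family k S :
  (S \in families k) =
  (S \in family (fun i => [pred A : {set _} | (A \subset J i) && (#|A| == k i)])).
Proof. by rewrite inE; apply/forallP/familyP => H i; have := H i; rewrite inE. Qed.

(** The product of binomials counts the families whose members all divide [f], that is, whose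
    product divides [f]; then the order of summation is exchanged. *)
Lemma sum_prod_bin (m : nat) (alpha : F) k :
  (\sum_(f in [set f in monics F m | nextcoef f == alpha])
     \prod_i 'C(nb_irred_factors (d i) f, k i) =
   \sum_(S in families k)
     #|[set f in monics F m |
         (nextcoef f == alpha) && (family_prod S %| polyn f)%R]|)%N.
Proof.
rewrite (eq_bigr (fun f : {poly_m.+1 F} => \sum_(S in families k)
   ((family_prod S %| polyn f)%R : nat))%N) => [|f _].
  rewrite exchange_big /=; apply: eq_bigr => S _.
  rewrite -big_mkcondr sum1dep_card; apply: eq_card => f.
  by rewrite !inE andbA.
transitivity (\sum_(S in families k)
   \prod_i (S i \subset [set P | polyn P %| f]%R : nat))%N; last first.
  apply: eq_bigr => S Sk; rewrite (dvdp_family d_inj dN Sk).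
  case: forallP => [H|/forallP/forallPn[i Hi]].
    by rewrite big1 // => i _; rewrite H.
  by rewrite (bigD1 i) //= (negbTE Hi).
rewrite (eq_bigl _ _ (families_family k)).
rewrite -(bigA_distr_big_dep _
  (fun (_ : I) (A : {set {poly_N.+1 F}}) => A \subset [set P | polyn P %| f] : nat)).
apply: eq_bigr => i _; rewrite (nb_irred_factors_wide dN) -cards_draws -sum1_card.
rewrite -big_mkcondr; apply: eq_bigl => A; rewrite !inE andbAC; congr (_ && _).
by rewrite -subsetI setIdE.
Qed.

Lemma card_families k : #|families k| = (\prod_i 'C(#|monic_irreds F (d i)|, k i))%N.
Proof.
rewrite -sum1_card (eq_bigl _ _ (families_family k)).
rewrite (eq_bigr (fun S : {ffun I -> {set _}} => \prod_(i : I) 1)%N); last first.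
  by move=> S _; rewrite big1.
rewrite -(bigA_distr_big_dep _ (fun (_ : I) (_ : {set {poly_N.+1 F}}) => 1%N)).
apply: eq_bigr => i _.
rewrite -(card_wide_irreds F dN) -cards_draws -sum1_card.
by apply: eq_bigl => A; rewrite !inE.
Qed.

(** [chi] of the second coefficient is multiplicative over the members, so the sum factors over [i]
    into elementary symmetric functions of the values of [chi] on each set of irreducibles. *)
Lemma sum_families_char (chi : F -> algC) k :
  chi 0 = 1 -> {morph chi : x y / x + y >-> x * y} ->
  \sum_(S in families k) chi (nextcoef (family_prod S)) =
  \prod_i (\prod_(P in monic_irreds F (d i)) (1 + chi (nextcoef P) *: 'X))`_(k i).
Proof.
move=> chi0 chiD.
rewrite (eq_bigr (fun S : {ffun I -> {set {poly_N.+1 F}}} =>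
  \prod_i \prod_(P in S i) chi (nextcoef (polyn P)))); last first.
  move=> S Sk; rewrite (nextcoef_family dN Sk).
  rewrite (big_morph chi chiD chi0); apply: eq_bigr => i _.
  by rewrite (big_morph chi chiD chi0).
rewrite (eq_bigl _ _ (families_family k)).
rewrite -(bigA_distr_big_dep _ (fun (_ : I) (A : {set {poly_N.+1 F}}) =>
  \prod_(P in A) chi (nextcoef (polyn P)))).
apply: eq_bigr => i _.
rewrite -(big_wide_irreds dN _ _ (fun P => 1 + chi (nextcoef P) *: 'X)).
by rewrite coef_prod_one_add; apply: eq_bigl => A; rewrite inE.
Qed.

(** The condition is detected by averaging over the characters [chi c]. The trivial one, [c = 0],
    counts all families; every other gives the same product of [A_coef], and the weights of these
    sum to [v_weight alpha]. *)
Lemma card_families_nextcoef p k (alpha : F) :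
  p \in [pchar F] -> (forall i, (0 < d i)%N) ->
  #|[set S in families k | nextcoef (family_prod S) == alpha]|%:R =
    q%:R^-1 * \prod_i 'C(#|monic_irreds F (d i)|, k i)%:R +
    v_weight alpha / q%:R *
      \prod_i A_coef p q (k i) (a_coef p q (d i)) (b_coef p q (d i)) :> rat.
Proof.
move=> pF d0; have q0 : q%:R != 0 :> rat := natr_card_neq0 F.
apply: (mulfI q0).
rewrite mulrDr mulVKf // mulrA [q%:R * (_ / _)]mulrC divfK //.
apply: (fmorph_inj (ratr : {rmorphism rat -> algC})).
have [psi [psiD psi0 [t0 psit0]]] := exists_additive_char F.
pose chi c x := psi (c * x).
have chiD c : {morph chi c : x y / x + y >-> x * y}.
  by move=> x y; rewrite /chi mulrDr psiD.
have chi0 c : chi c 0 = 1 by rewrite /chi mulr0.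
transitivity (\sum_c psi (c * - alpha) *
    \sum_(S in families k) chi c (nextcoef (family_prod S))).
  under eq_bigr => c _ do rewrite mulr_sumr.
  rewrite exchange_big /=.
  rewrite (eq_bigr (fun S => (q * (nextcoef (family_prod S) == alpha))%:R)).
    rewrite -natr_sum -big_distrr /= -natrM ratr_nat; congr (_ * _)%:R.
    rewrite -sum1_card big_mkcond [RHS]big_mkcond; apply: eq_bigr => S _.
    by rewrite inE; case: (S \in _).
  move=> S _; rewrite -subr_eq0 -(psi_orthogonality psiD psi0 psit0).
  by apply: eq_bigr => c _; rewrite -psiD -mulrDr addrC.
rewrite (bigD1 0) //= mul0r psi0 mul1r.
rewrite (eq_bigr (fun c => psi (c * - alpha) *
   ratr (\prod_i A_coef p q (k i) (a_coef p q (d i)) (b_coef p q (d i))))); last first.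
  move=> c c0; rewrite sum_families_char // rmorph_prod; congr (_ * _).
  apply: eq_bigr => i _.
  (* [t0 / c] witnesses that [chi c] is nontrivial, since it is sent to [psi t0]. *)
  apply: (coef_prod_irreds pF (chiD c) (chi0 c) (t0 := t0 / c)) => //.
  by rewrite /chi mulrC divfK.
rewrite -mulr_suml rmorphD rmorphM -natr_prod -card_families; congr (_ + _ * _).
  rewrite rmorph_nat (eq_bigr (fun _ => 1)) ?sumr_const // => S _.
  by rewrite /chi mul0r.
have := psi_orthogonality psiD psi0 psit0 (- alpha).
rewrite (bigD1 0) //= mul0r psi0 oppr_eq0 => /(canRL (addKr _))->.
by rewrite /v_weight rmorphB rmorph1 -natrM rmorph_nat addrC.
Qed.

End Count.

(** * The sieve *)

(** The integer exponent keeps Pascal's recurrence uniform when [r > k], where the binomial is 0. *)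
Lemma coef_XsubC1_exp (k r : nat) :
  (('X - 1 : {poly rat}) ^+ k)`_r = 'C(k, r)%:R * (-1) ^ (k%:Z - r%:Z).
Proof.
have S1 (x : int) : (-1) ^ (x + 1) = - (-1) ^ x :> rat.
  by rewrite expfzDr // expr1z mulrN1.
elim: k r => [|k IH] r.
  rewrite expr0 coef1; case: r => [|r]; first by rewrite bin0 subrr mul1r.
  by rewrite bin0n mul0r.
rewrite exprSr mulrBr mulr1 coefB coefMX; case: r => [|r] /=.
  by rewrite IH !bin0 !mul1r !subr0 sub0r [k.+1%:Z]intS addrC S1.
rewrite !IH binS natrD (_ : k.+1%:Z - r.+1%:Z = k%:Z - r%:Z); last by lia.
rewrite (_ : k%:Z - r%:Z = k%:Z - r.+1%:Z + 1); last by lia.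
by rewrite S1; ring.
Qed.

(* The coefficient of X^r in X^n = (1 + (X - 1))^n. *)
Lemma bin_inversion (n r M : nat) : (n <= M)%N ->
  \sum_(k < M.+1) 'C(k, r)%:R * (-1) ^ (k%:Z - r%:Z) * 'C(n, k)%:R = (n == r)%:R :> rat.
Proof.
move=> nM; have E : 'X^n = (1 + ('X - 1)) ^+ n :> {poly rat} by rewrite addrC subrK.
rewrite eq_sym -[RHS](coefXn rat) E exprDn coef_sum.
rewrite [RHS](big_ord_widen M.+1 (fun k : nat =>
  (1 ^+ (n - k) * ('X - 1 : {poly rat}) ^+ k *+ 'C(n, k))`_r)) ?ltnS //.
rewrite [RHS]big_mkcond; apply: eq_bigr => k _; rewrite expr1n mul1r coefMn.
rewrite coef_XsubC1_exp; case: ltnP => nk; first by rewrite mulr_natr.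
by rewrite [in LHS](bin_small nk) mulr0.
Qed.

(** The product of these distinct irreducibles divides [f], and each has degree at least 1. The
    bound lets the sieve stop at [k_i = m]. *)
Lemma nb_irred_factors_le (F : finFieldType) (i : nat) (f : {poly F}) m :
  (0 < i)%N -> f != 0 -> size f = m.+1 -> (nb_irred_factors i f <= m)%N.
Proof.
move=> i0 f0 sf; set A := [set g in monic_irreds F i | polyn g %| f].
have AP P : P \in A ->
    [/\ size P = i.+1, polyn P \is monic, irreducible_poly P & polyn P %| f].
  by rewrite inE => /andP[/monic_irredsP[]].
have : \prod_(P in A) polyn P %| f.
  rewrite dvdp_prod_coprime ?index_enum_uniq //.
    by apply/allP => P _; apply/implyP => /AP[].
  move=> P Q /AP[sP Pm Pi _] /AP[sQ Qm Qi _] PQ.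
  by apply: coprimep_irreducible.
move/dvdp_leq => /(_ f0); rewrite sf size_prod => [|P /AP[_ Pm _ _]]; last first.
  by rewrite monic_neq0.
rewrite (eq_bigr (fun _ => i.+1)) => [|P /AP[->]//].
rewrite sum_nat_const mulnS subSn ?leq_addr // addKn ltnS.
by apply: leq_trans; rewrite leq_pmulr.
Qed.

Lemma bin_mul_trinomial (n r j : nat) : (r + j <= n)%N ->
  ('C(r + j, r) * 'C(n, r + j) = 'C(n, r) * 'C(n - r, j))%N.
Proof.
move=> rjn; apply/eqP; have c0 : (0 < r`! * j`! * (n - (r + j))`!)%N.
  by rewrite !muln_gt0 !fact_gt0.
rewrite -(eqn_pmul2r c0); apply/eqP.
have e1 := bin_fact (leq_addr j r); rewrite addKn in e1.
have e2 := bin_fact rjn.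
have e3 := bin_fact (leq_trans (leq_addr j r) rjn).
have jnr : (j <= n - r)%N by lia.
have e4 := bin_fact jnr; rewrite -subnDA in e4.
transitivity n`!.
  by rewrite -e2 -e1; ring.
by rewrite -e3 -e4; ring.
Qed.

Section Sieve.
Variables (F : finFieldType) (I : finType) (d : I -> nat) (N : nat).
Hypothesis d_inj : injective d.
Hypothesis dN : forall i, (d i <= N)%N.
Hypothesis d0 : forall i, (0 < d i)%N.
Let q := #|F|.

(** The product of a family has degree [s]. For [s < m] it has [q ^ (m - s).-1] suitable multiples
    whatever [alpha] is, for [s = m] only itself can qualify, and for [s > m] there are none. *)
Lemma sum_prod_binE p m (alpha : F) k : p \in [pchar F] -> (0 < m)%N ->
  (\sum_(f in [set f in monics F m | nextcoef f == alpha])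
     \prod_i 'C(nb_irred_factors (d i) f, k i))%N%:R =
  (\sum_i d i * k i <= m)%N%:R * (q%:R ^+ m.-1 *
     \prod_i ('C(#|monic_irreds F (d i)|, k i)%:R * q%:R ^- (d i * k i))) +
  (\sum_i d i * k i == m)%N%:R * (v_weight alpha / q%:R *
     \prod_i A_coef p q (k i) (a_coef p q (d i)) (b_coef p q (d i))) :> rat.
Proof.
move=> pF m0; set s := (\sum_i d i * k i)%N.
have q0 : q%:R != 0 :> rat := natr_card_neq0 F.
rewrite (sum_prod_bin d_inj dN).
rewrite (eq_bigr (fun S : {ffun I -> _} => if (s <= m)%N then
    if (m - s)%N is n'.+1 then (q ^ n')%N
    else nat_of_bool (nextcoef (family_prod S) == alpha) else 0)%N); last first.
  move=> S Sk.
  rewrite (card_monics_dvd _ _ (family_prod_monic dN Sk) (size_family dN Sk)) -/s.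
  by rewrite card_monics_nextcoef; case: ifP => //; rewrite subr_eq0 eq_sym.
have prodq : \prod_i q%:R ^- (d i * k i) = q%:R ^- s :> rat.
  by rewrite prodfV -expr_sum.
rewrite big_split /= prodq -natr_prod -(card_families F dN).
case: (ltngtP s m) => [ltsm|ltms|sm].
- rewrite mul1r mul0r addr0.
  have [n' E] : exists n', (m - s)%N = n'.+1.
    by exists (m - s).-1; rewrite prednK // subn_gt0.
  rewrite E sum_nat_const natrM natrX mulrCA; congr (_ * _).
  have -> : m.-1 = (n' + s)%N by lia.
  by rewrite exprD mulfK // expf_neq0.
- by rewrite !mul0r addr0 big1.
rewrite !mul1r sm subnn -big_mkcondr sum1dep_card /=.
have := card_families_nextcoef dN k alpha pF d0.
rewrite -natr_prod -(card_families F dN) => ->; congr (_ + _).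
(* As [s = m], the factor [q ^ m.-1 * q ^- s] is [q^-1], the weight of the trivial character; this
   is how that character completes the first sum. *)
rewrite mulrCA mulrC; congr (_ * _).
by rewrite -{2}(prednK m0) exprS invfM mulrCA mulfV ?mulr1 // expf_neq0.
Qed.

(** For each [f], binomial inversion in every coordinate turns the sum over [k] into the indicator
    of the exact factor counts. *)
Lemma sieve_exact m (alpha : F) (r : I -> nat) :
  #|[set f in monics F m | (nextcoef f == alpha) &&
      [forall i, nb_irred_factors (d i) f == r i]]|%:R =
  \sum_(k : {ffun I -> 'I_m.+1})
    (\prod_i ('C(k i, r i)%:R * (-1) ^ ((k i)%:Z - (r i)%:Z))) *
    (\sum_(f in [set f in monics F m | nextcoef f == alpha])
     \prod_i 'C(nb_irred_factors (d i) f, k i))%N%:R :> rat.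
Proof.
under [RHS]eq_bigr => k _ do rewrite natr_sum mulr_sumr.
rewrite exchange_big /=.
rewrite (eq_bigr (fun f : {poly_m.+1 F} =>
    [forall i, nb_irred_factors (d i) f == r i]%:R)); last first.
  move=> f; rewrite !inE => /andP[/andP[/eqP sf fm] _].
  rewrite (eq_bigr (fun k : {ffun I -> 'I_m.+1} => \prod_i
    ('C(k i, r i)%:R * (-1) ^ ((k i)%:Z - (r i)%:Z) *
     'C(nb_irred_factors (d i) f, k i)%:R))); last first.
    by move=> k _; rewrite natr_prod -big_split.
  rewrite -(bigA_distr_bigA (fun i (k : 'I_m.+1) => 'C(k, r i)%:R *
     (-1) ^ (k%:Z - (r i)%:Z) * 'C(nb_irred_factors (d i) f, k)%:R)).
  rewrite (eq_bigr (fun i => (nb_irred_factors (d i) f == r i)%:R)).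
    case: forallP => [H|/forallP/forallPn[i Hi]].
      by rewrite big1 // => i _; rewrite (eqP (H i)) eqxx.
    by rewrite (bigD1 i) //= (negbTE Hi) mul0r.
  move=> i _; rewrite bin_inversion //.
  by apply: nb_irred_factors_le => //; rewrite monic_neq0.
rewrite -natr_sum -big_mkcondr sum1dep_card; congr _%:R.
by apply: eq_card => f; rewrite !inE andbA.
Qed.

(* Substitute k_i = r_i + j_i. *)
Lemma reindex_shift m (r : I -> nat) (n : I -> nat) (x : rat) :
  \sum_(k : {ffun I -> 'I_m.+1} | (\sum_i d i * k i <= m)%N)
    \prod_i ('C(k i, r i)%:R * (-1) ^ ((k i)%:Z - (r i)%:Z) *
       ('C(n i, k i)%:R * x ^- (d i * k i))) =
  \sum_(j : {dffun forall i : I, 'I_((n i).+1 - r i)}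
             | (\sum_i d i * (r i + j i) <= m)%N)
     \prod_i ('C(n i, r i)%:R * x ^- (d i * r i) * x ^- (d i * j i)
            * 'C(n i - r i, j i)%:R * (-1) ^+ (j i)) :> rat.
Proof.
(* If some [r i0 > n i0], the right-hand index type is empty, and each term on the left has a zero
   binomial: either [k i0 < r i0] or [n i0 < k i0]. *)
have [rn|/forallPn[i0]] := boolP [forall i, (r i <= n i)%N]; last first.
  rewrite -ltnNge => nr0; rewrite [RHS]big1 => [|j _]; last first.
    have := leq_ltn_trans (leq0n _) (ltn_ord (j i0)).
    by rewrite subn_gt0 ltnS leqNgt nr0.
  rewrite big1 // => k _; rewrite (bigD1 i0) //=.
  case: (leqP (r i0) (k i0)) => [rk|kr]; last by rewrite [in X in X * _]bin_small ?mul0r.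
  by rewrite ['C(n i0, _)]bin_small ?(leq_trans nr0) // !(mul0r, mulr0).
have z i : (0 < (n i).+1 - r i)%N by rewrite subn_gt0 ltnS; apply: (forallP rn).
rewrite (bigID (fun k : {ffun I -> 'I_m.+1} => [forall i, (r i <= k i <= n i)%N])) /=.
rewrite [X in _ + X]big1 ?addr0; last first.
  move=> k /andP[_ /forallPn[i]]; rewrite negb_and -!ltnNge => ki.
  rewrite (bigD1 i) //=; case/orP: ki => ki.
    by rewrite [in X in X * _](bin_small ki) !mul0r.
  by rewrite ['C(n i, _)](bin_small ki) !(mul0r, mulr0).
pose h (j : {dffun forall i : I, 'I_((n i).+1 - r i)}) : {ffun I -> 'I_m.+1} :=
  [ffun i => inord (r i + j i)].
pose h' (k : {ffun I -> 'I_m.+1}) : {dffun forall i : I, 'I_((n i).+1 - r i)} :=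
  [ffun i => insubd (Ordinal (z i)) (k i - r i)%N].
have h'K (k : {ffun I -> 'I_m.+1}) i :
    (r i <= k i <= n i)%N -> h' k i = (k i - r i)%N :> nat.
  move=> /andP[rk kn]; rewrite ffunE val_insubd ifT //.
  by rewrite -subSn // leq_sub2r // ltnS.
rewrite (reindex_onto h h') /=; last first.
  move=> k /andP[_ /forallP rk]; apply/ffunP => i.
  rewrite ffunE h'K // subnKC ?inord_val //.
  by have /andP[] := rk i.
have jn (j : {dffun forall i : I, 'I_((n i).+1 - r i)}) i : (r i + j i <= n i)%N.
  by have := ltn_ord (j i); rewrite ltn_subRL ltnS.
(* Since [d i] is positive, the degree constraint bounds [r i + j i] by [m], so [inord] does not
   fall back to its default. *)
have hE (j : {dffun forall i : I, 'I_((n i).+1 - r i)}) :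
    (\sum_i d i * (r i + j i) <= m)%N -> forall i, h j i = (r i + j i)%N :> nat.
  move=> jm i; rewrite ffunE inordK // ltnS (leq_trans _ jm) //.
  by rewrite (bigD1 i) //= (leq_trans _ (leq_addr _ _)) // leq_pmull.
apply: eq_big => [j|j]; last first.
  move=> /andP[/andP[_ /forallP rh] /eqP hj]; apply: eq_bigr => i _.
  have -> : h j i = (r i + j i)%N :> nat.
    by rewrite -{2}hj h'K // subnKC //; have /andP[] := rh i.
  have -> : (r i + j i)%:Z - (r i)%:Z = j i by rewrite PoszD addrC addKr.
  have -> : 'C(n i, r i)%:R * x ^- (d i * r i) * x ^- (d i * j i)
            * 'C(n i - r i, j i)%:R * (-1) ^+ (j i) =
    ('C(n i, r i) * 'C(n i - r i, j i))%:R * (-1) ^+ j i * x ^- (d i * (r i + j i)).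
    rewrite natrM mulnDr exprD invfM.
    move: (x ^- _) (x ^- _) ((-1) ^+ _) => X Y Z; ring.
  rewrite -bin_mul_trinomial // natrM -exprnP.
  by move: (x ^- _) ((-1) ^+ _) => X Z; ring.
(* Forwards, the constraint is known only for [h j], so [hE] does not apply yet; [h' (h j) = j]
   yields [h j i = r i + j i] instead. *)
apply/andP/idP => [[/andP[jm /forallP rh] /eqP hj]|jm].
  suff E i : h j i = (r i + j i)%N :> nat.
    by move: jm; under eq_bigr => i _ do rewrite E.
  by rewrite -{2}hj h'K // subnKC //; have /andP[] := rh i.
have E := hE j jm; split.
  under eq_bigr => i _ do rewrite E; rewrite jm /=.
  by apply/forallP => i; rewrite E leq_addr jn.
apply/eqP/ffunP => i; apply: val_inj; rewrite /= h'K E ?addKn //.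
by rewrite leq_addr jn.
Qed.

End Sieve.

(* The index type ['I_(#|I_i|.+1 - r_i)], with truncated subtraction, is the
   range 0 <= j_i <= #|I_i| - r_i, and is empty when r_i > #|I_i|.  In the
   second sum the constraint forces k_i <= m, as 0 is not in T, so bounding the
   k_i by m drops no tuple.  The last exponent is an integer, possibly
   negative. *)
Theorem theorem5 (p e : nat) (hp : prime p) (he : (1 <= e)%N)
    (F : finFieldType) (hF : #|F| = (p ^ e)%N)
    (T : {fset nat}) (hT : 0%N \notin T) (m : nat) (hm : (1 <= m)%N)
    (r : T -> nat) (alpha : F) :
  (nb_polys m r alpha)%:R =
    #|F|%:R ^+ m.-1 *
      (\sum_(j : {dffun forall i : T, 'I_(#|monic_irreds F (val i)|.+1 - r i)}
             | (\sum_(i : T) val i * (r i + j i) <= m)%N)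
         \prod_(i : T)
           ('C(#|monic_irreds F (val i)|, r i)%:R
            * #|F|%:R ^- (val i * r i) * #|F|%:R ^- (val i * j i)
            * 'C(#|monic_irreds F (val i)| - r i, j i)%:R * (-1) ^+ (j i)))
    + v_weight alpha / #|F|%:R *
      (\sum_(k : {ffun T -> 'I_m.+1} | (\sum_(i : T) val i * k i == m)%N)
         \prod_(i : T)
           (A_coef p #|F| (k i) (a_coef p #|F| (val i)) (b_coef p #|F| (val i))
            * 'C(k i, r i)%:R * (-1) ^ ((k i)%:Z - (r i)%:Z))) :> rat.
Proof.
have pF : p \in [pchar F] := card_finPcharP hF hp.
have d0 (i : T) : (0 < val i)%N.
  by rewrite lt0n; apply: contraNneq hT => <-; exact: valP.
(* A common degree bound, so that the irreducibles of all degrees in [T] live in one finite type. *)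
pose N := \max_(i : T) val i.
have dN (i : T) : (val i <= N)%N by exact: leq_bigmax.
have -> : nb_polys m r alpha =
    #|[set f in monics F m | (nextcoef f == alpha) &&
       [forall i : T, nb_irred_factors (val i) f == r i]]|.
  apply: eq_card => f; rewrite !inE; case: eqP => //= sf.
  by rewrite (@nextcoefE _ _ m.-1) // prednK.
rewrite (sieve_exact d0).
(* Each tuple [k] contributes a term under the constraint of degree at most [m] and a term under
   equality; these become the two sums of the statement. *)
under eq_bigr => k _ do rewrite (sum_prod_binE val_inj dN d0 _ _ pF hm) mulrDr.
rewrite big_split /=; congr (_ + _).
  rewrite -(reindex_shift d0) mulr_sumr [RHS]big_mkcond; apply: eq_bigr => k _.
  case: ifP => _; last by rewrite mul0r mulr0.
  by rewrite mul1r mulrCA -big_split.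
rewrite mulr_sumr [RHS]big_mkcond; apply: eq_bigr => k _.
case: ifP => _; last by rewrite mul0r mulr0.
rewrite mul1r mulrCA -big_split; congr (_ * _); apply: eq_bigr => i _ /=.
by rewrite mulrC mulrA.
Qed.
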